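(* Let $\mathfrak g$ be one of $\mathfrak{sl}_n$, $\mathfrak{so}_{2n+1}$, $\mathfrak{so}_{2n}$, $\mathfrak{sp}_{2n}$. Let $\mathcal B$ (resp. $\mathcal B'$) be the Hopf subalgebra of the two-parameter quantum group $U_{r,s}(\mathfrak g)$ generated by $e_j,\omega_j^{\pm1}$ (resp. $f_j,\omega_j'^{\pm1}$), $j\in I$. Then $U_{r,s}(\mathfrak g)$ is isomorphic, as a Hopf algebra, to the Drinfel'd quantum double $\mathcal D(\mathcal B,\mathcal B')$ formed with respect to the skew-dual pairing $\langle\,,\rangle:\mathcal B'\times\mathcal B\to\mathbb K$ determined by the values on generators given in the context.
   Context: Base field: $\mathbb K=\mathbb Q(r,s)$, where $r,s$ are either two indeterminates, or nonzero parameters in $\mathbb C$ with $r^2\ne s^2$. Roots: $\epsilon_1,\dots,\epsilon_n$ is an orthonormal basis of $\mathbb R^n$ with inner product $(\,,)$; $\alpha_i=\epsilon_i-\epsilon_{i+1}$ for $1\le i<n$, and $\alpha_n=\epsilon_n$ for $\mathfrak{so}_{2n+1}$ (type $B_n$, $n\ge2$), $\alpha_n=2\epsilon_n$ for $\mathfrak{sp}_{2n}$ (type $C_n$, $n\ge2$), $\alpha_n=\epsilon_{n-1}+\epsilon_n$ for $\mathfrak{so}_{2n}$ (type $D_n$, $n\ge4$). Index set $I=\{1,\dots,n-1\}$ for $\mathfrak{sl}_n$ (type $A_{n-1}$), $I=\{1,\dots,n\}$ otherwise. $a_{ij}=2(\alpha_i,\alpha_j)/(\alpha_i,\alpha_i)$.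 Put $r_i=r^{(\alpha_i,\alpha_i)}$, $s_i=s^{(\alpha_i,\alpha_i)}$ in type $B$ and $r_i=r^{(\alpha_i,\alpha_i)/2}$, $s_i=s^{(\alpha_i,\alpha_i)/2}$ in types $A,C,D$. Structure constants $p_{ij}$, $i,j\in I$: Type $A$: $p_{ij}=r^{(\epsilon_j,\alpha_i)}s^{(\epsilon_{j+1},\alpha_i)}$. Type $B$: $p_{ij}=r^{2(\epsilon_j,\alpha_i)}s^{2(\epsilon_{j+1},\alpha_i)}$ if $j<n$; $p_{in}=r^{2(\epsilon_n,\alpha_i)}$ if $i<n$; $p_{nn}=rs^{-1}$. Type $C$: $p_{ij}=r^{(\epsilon_j,\alpha_i)}s^{(\epsilon_{j+1},\alpha_i)}$ if $j<n$; $p_{in}=r^{2(\epsilon_n,\alpha_i)}$ if $i<n$; $p_{nn}=r^2s^{-2}$. Type $D$: $p_{ij}=r^{(\epsilon_j,\alpha_i)}s^{(\epsilon_{j+1},\alpha_i)}$ if $j<n$; $p_{in}=r^{(\epsilon_{n-1},\alpha_i)}s^{-(\epsilon_n,\alpha_i)}$ if $i\ne n-1$; $p_{n-1,n}=r^{-1}s^{-1}$. $U_{r,s}(\mathfrak g)$ is the unital associative $\mathbb K$-algebra generated by $e_i,f_i,\omega_i^{\pm1},\omega_i'^{\pm1}$ ($i\in I$) subject to: (1) the $\omega_i^{\pm1},\omega_j'^{\pm1}$ all commute and $\omega_i\omega_i^{-1}=\omega_j'\omega_j'^{-1}=1$; (2) $\omega_je_i\omega_j^{-1}=p_{ij}e_i$,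 $\ \omega_jf_i\omega_j^{-1}=p_{ij}^{-1}f_i$; (3) $\omega_j'e_i\omega_j'^{-1}=p_{ji}^{-1}e_i$, $\ \omega_j'f_i\omega_j'^{-1}=p_{ji}f_i$; (4) $[e_i,f_j]=\delta_{ij}\dfrac{\omega_i-\omega_i'}{r_i-s_i}$; (5) ($e$-Serre relations) Types $A,B,C$: $[e_i,e_j]=0$ for $|i-j|>1$. Type $D$: $[e_i,e_j]=0$ for $i\neq j$ with $a_{ij}=0$ and $\{i,j\}\ne\{n-1,n\}$, and $e_{n-1}e_n=rs\,e_ne_{n-1}$. Types $A,D$: for $i<j$ in $I$ with $a_{ij}=-1$, $e_i^2e_j-(r+s)e_ie_je_i+rs\,e_je_i^2=0$ and $e_j^2e_i-(r^{-1}+s^{-1})e_je_ie_j+r^{-1}s^{-1}e_ie_j^2=0$. Type $B$: $e_i^2e_{i+1}-(r_i+s_i)e_ie_{i+1}e_i+r_is_i\,e_{i+1}e_i^2=0$ for $1\le i<n$; $e_{j+1}^2e_j-(r_{j+1}^{-1}+s_{j+1}^{-1})e_{j+1}e_je_{j+1}+r_{j+1}^{-1}s_{j+1}^{-1}e_je_{j+1}^2=0$ for $1\le j<n-1$; $e_n^3e_{n-1}-(r^{-2}+r^{-1}s^{-1}+s^{-2})e_n^2e_{n-1}e_n+r^{-1}s^{-1}(r^{-2}+r^{-1}s^{-1}+s^{-2})e_ne_{n-1}e_n^2-r^{-3}s^{-3}e_{n-1}e_n^3=0$. Type $C$: for $1\le i<n-1$, $e_i^2e_{i+1}-(r+s)e_ie_{i+1}e_i+rs\,e_{i+1}e_i^2=0$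 and $e_{i+1}^2e_i-(r^{-1}+s^{-1})e_{i+1}e_ie_{i+1}+r^{-1}s^{-1}e_ie_{i+1}^2=0$; $e_{n-1}^3e_n-(r^2+rs+s^2)e_{n-1}^2e_ne_{n-1}+rs(r^2+rs+s^2)e_{n-1}e_ne_{n-1}^2-(rs)^3e_ne_{n-1}^3=0$; $e_n^2e_{n-1}-(r^{-2}+s^{-2})e_ne_{n-1}e_n+r^{-2}s^{-2}e_{n-1}e_n^2=0$. (6) ($f$-Serre relations) each relation in (5) with every word reversed and every $e_k$ replaced by $f_k$. Hopf structure: $\omega_i^{\pm1},\omega_i'^{\pm1}$ are group-like, $\Delta(e_i)=e_i\otimes1+\omega_i\otimes e_i$, $\Delta(f_i)=1\otimes f_i+f_i\otimes\omega_i'$, $\varepsilon(e_i)=\varepsilon(f_i)=0$, $S(e_i)=-\omega_i^{-1}e_i$, $S(f_i)=-f_i\omega_i'^{-1}$. Skew-dual pairing: a bilinear form $\langle\,,\rangle:\mathcal U\times\mathcal A\to\mathbb K$ of Hopf algebras with $\langle f,1\rangle=\varepsilon(f)$, $\langle1,a\rangle=\varepsilon(a)$, $\langle f,a_1a_2\rangle=\langle\Delta^{\mathrm{op}}(f),a_1\otimes a_2\rangle$, $\langle f_1f_2,a\rangle=\langle f_1\otimes f_2,\Delta(a)\rangle$. The pairing $\langle\,,\rangle:\mathcal B'\times\mathcal B\to\mathbb K$ used here is the unique skew-dual pairing with $\langle f_i,e_j\rangle=\delta_{ij}/(s_i-r_i)$, $\langle\omega_i',\omega_j\rangle=p_{ij}$,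 $\langle\omega_i'^{\pm1},\omega_j^{-1}\rangle=\langle\omega_i'^{\pm1},\omega_j\rangle^{-1}=p_{ij}^{\mp1}$, all other pairs of generators pairing to $0$. Drinfel'd double: for Hopf algebras $\mathcal A,\mathcal U$ with a skew-dual pairing $\langle\,,\rangle:\mathcal U\times\mathcal A\to\mathbb K$, $\mathcal D(\mathcal A,\mathcal U)$ is the Hopf algebra with underlying space $\mathcal A\otimes\mathcal U$, tensor product coalgebra structure, multiplication $(a\otimes f)(a'\otimes f')=\sum\langle S_{\mathcal U}(f_{(1)}),a'_{(1)}\rangle\langle f_{(3)},a'_{(3)}\rangle\,aa'_{(2)}\otimes f_{(2)}f'$, and antipode $S(a\otimes f)=(1\otimes S_{\mathcal U}(f))(S_{\mathcal A}(a)\otimes1)$. *)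

(* Defs.v *)
From HB Require Import structures.
From mathcomp Require Import all_boot all_order all_algebra.
From mathcomp Require Import boolp reals.
From mathcomp Require Import complex.
From mathcomp Require Import monalg.

Set Implicit Arguments.
Unset Strict Implicit.
Unset Printing Implicit Defensive.

Import Order.TTheory GRing.Theory Num.Theory.
Local Open Scope ring_scope.
Local Open Scope quotient_scope.

(* -------------------------------------------------------------------- *)
(* Tensor products.  V (x) W is the quotient of the formal sums          *)
(* v1 (x) w1 + ... + vk (x) wk, represented by sequences of pairs, by    *)
(* the bilinearity relations.                                            *)

Section Tensor.
Variables (K : fieldType) (V W : lmodType K).

Inductive tens_eq : seq (V * W) -> seq (V * W) -> Prop :=
| TensRefl s : tens_eq s s
| TensSym s t : tens_eq s t -> tens_eq t s
| TensTrans s t u : tens_eq s t -> tens_eq t u -> tens_eq s u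
| TensCat s s' t t' : tens_eq s s' -> tens_eq t t' ->
    tens_eq (s ++ t) (s' ++ t')
| TensC s t : tens_eq (s ++ t) (t ++ s)
| TensDl v v' w : tens_eq [:: (v + v', w)] [:: (v, w); (v', w)]
| TensDr v w w' : tens_eq [:: (v, w + w')] [:: (v, w); (v, w')]
| TensZ a v w : tens_eq [:: (a *: v, w)] [:: (v, a *: w)]
| Tens0 : tens_eq [:: (0, 0)] [::].

Definition tens_eqb : rel (seq (V * W)) := fun s t => `[< tens_eq s t >].

Lemma tens_eqb_refl : reflexive tens_eqb.
Proof. by move=> s; apply/asboolP; apply: TensRefl. Qed.

Lemma tens_eqb_sym : symmetric tens_eqb.
Proof.
by move=> s t; apply/asboolP/asboolP; apply: TensSym.
Qed.

Lemma tens_eqb_trans : transitive tens_eqb.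
Proof.
by move=> t s u /asboolP st /asboolP tu; apply/asboolP; apply: TensTrans tu.
Qed.

Canonical tens_equiv := EquivRel tens_eqb
  tens_eqb_refl tens_eqb_sym tens_eqb_trans.

Definition tens := {eq_quot tens_eqb}.
HB.instance Definition _ := Choice.on tens.
HB.instance Definition _ := EqQuotient.on tens.

Definition tpi (s : seq (V * W)) : tens := \pi_tens s.
Definition sumrep (x : tens) : seq (V * W) := repr x.

Lemma sumrepK x : tpi (sumrep x) = x.
Proof. exact: reprK. Qed.

Lemma tpiP s t : tpi s = tpi t <-> tens_eq s t.
Proof.
split; first by move/eqP; rewrite eqmodE => /asboolP.
by move=> st; apply/eqP; rewrite eqmodE; apply/asboolP.
Qed.

Lemma sumrep_pi s : tens_eq (sumrep (tpi s)) s.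
Proof. by apply/tpiP; rewrite sumrepK. Qed.

Definition pure (v : V) (w : W) : tens := tpi [:: (v, w)].

Definition tens_zero : tens := tpi [::].
Definition tens_add (x y : tens) : tens := tpi (sumrep x ++ sumrep y).
Definition tens_scale (a : K) (x : tens) : tens :=
  tpi [seq (a *: p.1, p.2) | p <- sumrep x].

Lemma tens_addE s t : tens_add (tpi s) (tpi t) = tpi (s ++ t).
Proof. by apply/tpiP; apply: TensCat; apply: sumrep_pi. Qed.

Lemma tens_scale_eq a s t : tens_eq s t ->
  tens_eq [seq (a *: p.1, p.2) | p <- s] [seq (a *: p.1, p.2) | p <- t].
Proof.
elim=> {s t} [s|s t _ IH|s t u _ IH1 _ IH2|s s' t t' _ IH1 _ IH2|s t|v v' w|
  v w w'|b v w|] /=.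
- exact: TensRefl.
- exact: TensSym.
- exact: TensTrans IH2.
- by rewrite !map_cat; apply: TensCat.
- by rewrite !map_cat; apply: TensC.
- by rewrite scalerDr; apply: TensDl.
- exact: TensDr.
- by rewrite scalerA mulrC -scalerA; apply: TensZ.
- by rewrite scaler0; apply: Tens0.
Qed.

Lemma tens_scaleE a s :
  tens_scale a (tpi s) = tpi [seq (a *: p.1, p.2) | p <- s].
Proof. by apply/tpiP/tens_scale_eq/sumrep_pi. Qed.

Lemma tens_ind (P : tens -> Prop) : (forall s, P (tpi s)) -> forall x, P x.
Proof. by move=> Ps x; rewrite -(sumrepK x). Qed.

Lemma tens_addA : associative tens_add.
Proof.
by do 3!elim/tens_ind=> ?; rewrite !tens_addE catA.
Qed.

Lemma tens_addC : commutative tens_add.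
Proof.
by do 2!elim/tens_ind=> ?; rewrite !tens_addE; apply/tpiP/TensC.
Qed.

Lemma tens_add0 : left_id tens_zero tens_add.
Proof. by elim/tens_ind=> s; rewrite tens_addE. Qed.

Lemma tens_eq0l w : tens_eq [:: (0, w)] [::].
Proof.
rewrite -(scale0r (0 : V)); apply: TensTrans (TensZ _ _ _) _.
by rewrite scale0r; apply: Tens0.
Qed.

Lemma tens_addN : left_inverse tens_zero (tens_scale (-1)) tens_add.
Proof.
elim/tens_ind=> s; rewrite tens_scaleE tens_addE; apply/tpiP.
elim: s => [|[v w] s IHs] /=; first exact: TensRefl.
set t := map _ _ in IHs *.
have C (a b c d : seq (V * W)) :
    tens_eq (a ++ b ++ c ++ d) ((a ++ c) ++ (b ++ d)).
  rewrite -[X in tens_eq _ X]catA; apply: TensCat; first exact: TensRefl.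
  rewrite !catA; apply: TensCat; last exact: TensRefl.
  exact: TensC.
apply: TensTrans (C [:: _] t [:: _] s) _.
rewrite -[X in tens_eq _ X]cats0; apply: TensCat => //=.
apply: TensTrans (TensSym (TensDl _ _ _)) _.
by rewrite scaleN1r addNr; apply: tens_eq0l.
Qed.

HB.instance Definition _ := GRing.isZmodule.Build tens
  tens_addA tens_addC tens_add0 tens_addN.

Lemma tens_scaleA a b x :
  tens_scale a (tens_scale b x) = tens_scale (a * b) x.
Proof.
elim/tens_ind: x => s; rewrite !tens_scaleE -map_comp.
by congr tpi; apply: eq_map => p /=; rewrite scalerA.
Qed.

Lemma tens_scale1 : left_id 1 tens_scale.
Proof.
elim/tens_ind=> s; rewrite !tens_scaleE; congr tpi.
by rewrite -[RHS]map_id; apply: eq_map => -[v w] /=; rewrite scale1r.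
Qed.

Lemma tens_scaleDr : right_distributive tens_scale +%R.
Proof.
move=> a; do 2!elim/tens_ind=> ?.
by rewrite [_ + _]tens_addE !tens_scaleE [RHS]tens_addE map_cat.
Qed.

Lemma tens_scaleDl x : {morph tens_scale^~ x : a b / a + b}.
Proof.
move=> a b; elim/tens_ind: x => s; rewrite !tens_scaleE [RHS]tens_addE.
apply/tpiP; elim: s => [|[v w] s IHs] /=; first exact: TensRefl.
set t := map _ _; set t1 := map _ _; set t2 := map _ _.
apply: (@TensTrans _ (([:: (a *: v, w)] ++ [:: (b *: v, w)]) ++ (t1 ++ t2))).
  rewrite -[_ :: t]cat1s; apply: TensCat => //.
  by rewrite scalerDl; apply: TensDl.
rewrite -catA -[_ :: _ ++ _]cat1s; apply: TensCat; first exact: TensRefl.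
rewrite -[(b *: v, w) :: t2]cat1s !catA.
by apply: TensCat; [apply: TensC | apply: TensRefl].
Qed.

HB.instance Definition _ := GRing.Zmodule_isLmodule.Build K tens
  tens_scaleA tens_scale1 tens_scaleDr tens_scaleDl.

Lemma pure_sumE (x : tens) : x = \sum_(p <- sumrep x) pure p.1 p.2.
Proof.
rewrite -{1}(sumrepK x); elim: (sumrep x) => [|[v w] s IHs].
  by rewrite big_nil.
by rewrite big_cons -IHs [RHS]tens_addE.
Qed.

Definition bilinear_map (Z : lmodType K) (b : V -> W -> Z) : Prop :=
  (forall v, linear (b v)) /\ (forall w, linear (b^~ w)).

Lemma pure_bilinear : bilinear_map pure.
Proof.
split=> [v a w w'|w a v v'].
  rewrite [a *: pure _ _]tens_scaleE [RHS]tens_addE; apply/tpiP => /=.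
  apply: TensTrans (TensDr _ _ _) _; rewrite -cat1s -[X in tens_eq _ X]cat1s.
  apply: TensCat; [exact/TensSym/TensZ | exact: TensRefl].
by rewrite [a *: pure _ _]tens_scaleE [RHS]tens_addE; apply/tpiP/TensDl.
Qed.

(* For bilinear b, [tlift b] is the linear map v (x) w |-> b v w (lemmas *)
(* tlift_linear and tlift_pure): in Sweedler notation,                   *)
(* [tlift (fun x1 x2 => E) (Delta x)] is \sum E with Delta x = x1 (x) x2. *)
Definition tlift (Z : lmodType K) (b : V -> W -> Z) (x : tens) : Z :=
  \sum_(p <- sumrep x) b p.1 p.2.

Section Lift.
Variables (Z : lmodType K) (b : V -> W -> Z).
Hypothesis bP : bilinear_map b.

Let linD (U U' : lmodType K) (f : U -> U') : linear f -> {morph f : x y / x + y}.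
Proof. by move=> fL x y; rewrite -[x in LHS]scale1r fL scale1r. Qed.

Let lin0 (U U' : lmodType K) (f : U -> U') : linear f -> f 0 = 0.
Proof.
by move=> fL; have := fL (-1) 0 0; rewrite scaler0 addr0 scaleN1r addNr.
Qed.

Let linZ (U U' : lmodType K) (f : U -> U') a x : linear f -> f (a *: x) = a *: f x.
Proof. by move=> fL; have := fL a x 0; rewrite (lin0 fL) !addr0. Qed.

Lemma tlift_pi s : tlift b (tpi s) = \sum_(p <- s) b p.1 p.2.
Proof.
have [bl br] := bP.
suff E s1 s2 : tens_eq s1 s2 ->
  \sum_(p <- s1) b p.1 p.2 = \sum_(p <- s2) b p.1 p.2 by apply/E/sumrep_pi.
elim=> {s s1 s2} [s|s t _ ->|s t u _ IH1 _ IH2|s s' t t' _ IH1 _ IH2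
  |s t|v v' w|v w w'|a v w|] //.
- by rewrite IH1.
- by rewrite !big_cat /= IH1 IH2.
- by rewrite !big_cat /= addrC.
- by rewrite !big_cons !big_nil !addr0 /= (linD (br w)).
- by rewrite !big_cons !big_nil !addr0 /= (linD (bl v)).
- by rewrite !big_cons !big_nil !addr0 /= (linZ _ _ (br w)) (linZ _ _ (bl v)).
- by rewrite !big_cons !big_nil addr0 /= (lin0 (bl 0)).
Qed.

Lemma tlift_pure v w : tlift b (pure v w) = b v w.
Proof. by rewrite tlift_pi big_cons big_nil addr0. Qed.

Lemma tlift_linear : linear (tlift b).
Proof.
move=> a; do 2!elim/tens_ind=> ?.
rewrite [a *: _]tens_scaleE [_ + _]tens_addE !tlift_pi big_cat big_map.
rewrite scaler_sumr; congr (_ + _); apply: eq_bigr => p _ /=.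
by have [_ br] := bP; rewrite (linZ _ _ (br _)).
Qed.

End Lift.

End Tensor.

Arguments pure {K V W} v w.
Notation "v [x] w" := (pure v w) (at level 40, left associativity,
  format "v  [x]  w") : ring_scope.

Definition tmap (K : fieldType) (V V' W W' : lmodType K)
    (f : V -> V') (g : W -> W') : tens V W -> tens V' W' :=
  tlift (fun v w => f v [x] g w).

Definition tassoc (K : fieldType) (V W X : lmodType K) :
    tens (tens V W) X -> tens V (tens W X) :=
  tlift (fun vw x => tlift (fun v w => v [x] (w [x] x)) vw).

(* The multiplication (h (x) k) (h' (x) k') = h h' (x) k k' of H (x) H.   *)
Definition tmul (K : fieldType) (H : lmodType K) (mul : H -> H -> H)
    (x y : tens H H) : tens H H :=
  tlift (fun h k => tlift (fun h' k' => mul h h' [x] mul k k') y) x.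

(* -------------------------------------------------------------------- *)

Record hopf_struct (K : fieldType) (H : algType K) := HopfStruct {
  comul : {linear H -> tens H H};
  counit : {linear H -> K^o};
  antip : {linear H -> H};
  comulA : forall x, tassoc (tmap comul id (comul x)) = tmap id comul (comul x);
  counitl : forall x, tlift (fun h k => counit h *: k) (comul x) = x;
  counitr : forall x, tlift (fun h k => counit k *: h) (comul x) = x;
  comul1 : comul 1 = 1 [x] 1;
  comulM : forall x y, comul (x * y) = tmul *%R (comul x) (comul y);
  counit1 : counit 1 = 1;
  counitM : forall x y, counit (x * y) = counit x * counit y;
  antipl : forall x, tlift (fun h k => antip h * k) (comul x) = (counit x)%:A;
  antipr : forall x, tlift (fun h k => h * antip k) (comul x) = (counit x)%:A
}.

(* A vector space with the operations of a Hopf algebra, without axioms:  *)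
(* the axioms pass from one side to the other along a [hopf_isomorphic].  *)
Record hopf_data (K : fieldType) := HopfData {
  hcarrier :> lmodType K;
  hone : hcarrier;
  hmul : hcarrier -> hcarrier -> hcarrier;
  hcomul : hcarrier -> tens hcarrier hcarrier;
  hcounit : hcarrier -> K;
  hantip : hcarrier -> hcarrier
}.

Definition hopf_of (K : fieldType) (H : algType K) (hH : hopf_struct H) :
    hopf_data K :=
  @HopfData K H 1 *%R (comul hH) (counit hH) (antip hH).

Definition hopf_morphism (K : fieldType) (H H' : hopf_data K) (f : H -> H') : Prop :=
  linear f /\ f (hone H) = hone H' /\
  (forall x y, f (hmul x y) = hmul (f x) (f y)) /\
  (forall x, hcomul (f x) = tmap f f (hcomul x)) /\
  (forall x, hcounit (f x) = hcounit x) /\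
  (forall x, f (hantip x) = hantip (f x)).

Definition hopf_isomorphic (K : fieldType) (H H' : hopf_data K) : Prop :=
  exists2 f : H -> H', hopf_morphism f & bijective f.

(* -------------------------------------------------------------------- *)

Section Double.
Variables (K : fieldType) (A U : algType K).
Variables (hA : hopf_struct A) (hU : hopf_struct U) (phi : U -> A -> K).

Definition skew_dual_pairing : Prop :=
  (forall f, linear (phi f : A -> K^o)) /\
  (forall a, linear (phi^~ a : U -> K^o)) /\
  (forall f, phi f 1 = counit hU f) /\
  (forall a, phi 1 a = counit hA a) /\
  (forall f a1 a2, phi f (a1 * a2) =
     tlift (fun f1 f2 => phi f2 a1 * phi f1 a2 : K^o) (comul hU f)) /\
  (forall f1 f2 a, phi (f1 * f2) a =
     tlift (fun a1 a2 => phi f1 a1 * phi f2 a2 : K^o) (comul hA a)).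

(* \sum b h_(1) h_(2) h_(3) *)
Definition sweedler3 (H : algType K) (hH : hopf_struct H) (Z : lmodType K)
    (h : H) (b : H -> H -> H -> Z) : Z :=
  tlift (fun h1 h23 => tlift (fun h2 h3 => b h1 h2 h3) (comul hH h23))
        (comul hH h).

Definition double_mul (x y : tens A U) : tens A U :=
  tlift (fun a f => tlift (fun a' f' =>
    sweedler3 hU f (fun f1 f2 f3 => sweedler3 hA a' (fun a1 a2 a3 =>
      (phi (antip hU f1) a1 * phi f3 a3) *: ((a * a2) [x] (f2 * f')))))
    y) x.

Definition double_comul : tens A U -> tens (tens A U) (tens A U) :=
  tlift (fun a f => tlift (fun a1 a2 => tlift (fun f1 f2 =>
    (a1 [x] f1) [x] (a2 [x] f2)) (comul hU f)) (comul hA a)).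

Definition double_counit : tens A U -> K :=
  tlift (fun a f => counit hA a * counit hU f : K^o).

Definition double_antip : tens A U -> tens A U :=
  tlift (fun a f => double_mul (1 [x] antip hU f) (antip hA a [x] 1)).

Definition drinfeld_double : hopf_data K :=
  @HopfData K (tens A U) (1 [x] 1)
    double_mul double_comul double_counit double_antip.

End Double.

(* -------------------------------------------------------------------- *)
(* The subalgebra of A generated by a family g, as an algebra.           *)

Section GeneratedSubalgebra.
Variables (K : fieldType) (A : algType K) (T : Type) (g : T -> A).

Inductive generated : A -> Prop :=
| GenIn t : generated (g t)
| GenScalar a : generated a%:A
| GenAdd x y : generated x -> generated y -> generated (x + y)
| GenMul x y : generated x -> generated y -> generated (x * y).

Definition generated_pred : {pred A} := fun x => `[< generated x >].

Lemma generated_subalg : subalg_closed generated_pred.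
Proof.
have sc a x : generated x -> generated (a *: x).
  by move=> gx; rewrite -mulr_algl; apply: GenMul gx; apply: GenScalar.
split.
- by apply/asboolP; rewrite -(scale1r 1); apply: GenScalar.
- by move=> a x y /asboolP gx /asboolP gy; apply/asboolP/GenAdd => //; apply: sc.
- by move=> x y /asboolP gx /asboolP gy; apply/asboolP/GenMul.
Qed.

HB.instance Definition _ :=
  GRing.isSubalgClosed.Build K A generated_pred generated_subalg.

Record subalg_gen := SubalgGen {
  subalg_val :> A;
  subalg_valP : subalg_val \in generated_pred
}.

HB.instance Definition _ := [isSub for subalg_val].
HB.instance Definition _ := [Choice of subalg_gen by <:].
HB.instance Definition _ := [SubChoice_isSubAlgebra of subalg_gen by <:].

Lemma generated_gen t : g t \in generated_pred.
Proof. by apply/asboolP; apply: GenIn. Qed.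

Definition sgen (t : T) : subalg_gen := SubalgGen (generated_gen t).

(* The generated subalgebra is a Hopf subalgebra: its Hopf structure is   *)
(* the restriction of that of A.                                         *)
Definition hopf_subalgebra (hA : hopf_struct A) (hB : hopf_struct subalg_gen) :
    Prop :=
  @hopf_morphism K (hopf_of hB) (hopf_of hA) subalg_val.

End GeneratedSubalgebra.

(* -------------------------------------------------------------------- *)
(* The quotient of an algebra F by the two-sided ideal generated by the   *)
(* differences x - y with R x y.  MathComp's algebras are nonzero, hence  *)
(* the side condition [nz].                                              *)

Section Presented.
Variables (K : fieldType) (F : algType K) (R : F -> F -> Prop).

Inductive ideal : F -> Prop :=
| Ideal0 : ideal 0
| IdealD x y : ideal x -> ideal y -> ideal (x + y)
| IdealRel a b x y : R x y -> ideal (a * (x - y) * b).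

Definition ideal_eqb : rel F := fun x y => `[< ideal (x - y) >].

Lemma pidealN x : ideal x -> ideal (- x).
Proof.
elim=> [|{}x y _ IHx _ IHy|a b {}x y xy]; first by rewrite oppr0; apply: Ideal0.
  by rewrite opprD; apply: IdealD.
by rewrite -mulNr -mulNr; apply: IdealRel.
Qed.

Lemma pidealMl a x : ideal x -> ideal (a * x).
Proof.
elim=> [|{}x y _ IHx _ IHy|c d {}x y xy]; first by rewrite mulr0; apply: Ideal0.
  by rewrite mulrDr; apply: IdealD.
by rewrite !mulrA -[a * c * _]/((a * c) * (x - y)); apply: IdealRel.
Qed.

Lemma pidealMr a x : ideal x -> ideal (x * a).
Proof.
elim=> [|{}x y _ IHx _ IHy|c d {}x y xy]; first by rewrite mul0r; apply: Ideal0.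
  by rewrite mulrDl; apply: IdealD.
by rewrite -mulrA; apply: IdealRel.
Qed.

Lemma peqb_refl : reflexive ideal_eqb.
Proof. by move=> x; apply/asboolP; rewrite subrr; apply: Ideal0. Qed.

Lemma peqb_sym : symmetric ideal_eqb.
Proof. by move=> x y; apply/asboolP/asboolP => /pidealN; rewrite opprB. Qed.

Lemma peqb_trans : transitive ideal_eqb.
Proof.
move=> y x z /asboolP xy /asboolP yz; apply/asboolP.
by rewrite -(subrKA y); apply: IdealD.
Qed.

Canonical pequiv := EquivRel ideal_eqb peqb_refl peqb_sym peqb_trans.

Definition presented (_ : ~ ideal 1) : Type := {eq_quot ideal_eqb}.

Section Structure.
Hypothesis nz : ~ ideal 1.
Local Notation Q := (presented nz).
HB.instance Definition _ := Choice.on Q.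
HB.instance Definition _ := EqQuotient.on Q.

Definition ppi (x : F) : Q := \pi_Q x.

Lemma ppiP x y : ppi x = ppi y <-> ideal (x - y).
Proof.
split; first by move/eqP; rewrite eqmodE => /asboolP.
by move=> xy; apply/eqP; rewrite eqmodE; apply/asboolP.
Qed.

Lemma presented_ind (P : Q -> Prop) :
  (forall x, P (ppi x)) -> forall x, P x.
Proof. by move=> Px x; rewrite -(reprK x). Qed.

Let preprb x : ideal (repr (ppi x) - x).
Proof. by apply/ppiP; apply: reprK. Qed.

Definition padd (x y : Q) : Q := ppi (repr x + repr y).
Definition popp (x : Q) : Q := ppi (- repr x).
Definition pmul (x y : Q) : Q := ppi (repr x * repr y).
Definition pscale (a : K) (x : Q) : Q := ppi (a *: repr x).

Lemma paddE x y : padd (ppi x) (ppi y) = ppi (x + y).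
Proof. by apply/ppiP; rewrite opprD addrACA; apply: IdealD. Qed.

Lemma poppE x : popp (ppi x) = ppi (- x).
Proof. by apply/ppiP; rewrite -opprD; apply: pidealN. Qed.

Lemma pmulE x y : pmul (ppi x) (ppi y) = ppi (x * y).
Proof.
apply/ppiP; rewrite -(subrKA (x * repr (ppi y))) -mulrBl -mulrBr.
by apply: IdealD; [apply: pidealMr | apply: pidealMl].
Qed.

Lemma pscaleE a x : pscale a (ppi x) = ppi (a *: x).
Proof.
by apply/ppiP; rewrite -scalerBr -mulr_algl; apply: pidealMl.
Qed.

Lemma paddA : associative padd.
Proof. by do 3!elim/presented_ind=> ?; rewrite !paddE addrA. Qed.

Lemma paddC : commutative padd.
Proof. by do 2!elim/presented_ind=> ?; rewrite !paddE addrC. Qed.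

Lemma padd0 : left_id (ppi 0) padd.
Proof. by elim/presented_ind=> ?; rewrite !paddE add0r. Qed.

Lemma paddN : left_inverse (ppi 0) popp padd.
Proof. by elim/presented_ind=> ?; rewrite poppE paddE addNr. Qed.

HB.instance Definition _ := GRing.isZmodule.Build Q
  paddA paddC padd0 paddN.

Lemma pmulA : associative pmul.
Proof. by do 3!elim/presented_ind=> ?; rewrite !pmulE mulrA. Qed.

Lemma pmul1l : left_id (ppi 1) pmul.
Proof. by elim/presented_ind=> ?; rewrite !pmulE mul1r. Qed.

Lemma pmul1r : right_id (ppi 1) pmul.
Proof. by elim/presented_ind=> ?; rewrite !pmulE mulr1. Qed.

Lemma pmulDl : left_distributive pmul +%R.
Proof.
by do 3!elim/presented_ind=> ?; rewrite [_ + _]paddE !pmulE mulrDl [RHS]paddE.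
Qed.

Lemma pmulDr : right_distributive pmul +%R.
Proof.
by do 3!elim/presented_ind=> ?; rewrite [_ + _]paddE !pmulE mulrDr [RHS]paddE.
Qed.

Lemma p1_neq0 : ppi 1 != 0.
Proof. by apply/eqP => /ppiP; rewrite subr0. Qed.

HB.instance Definition _ := GRing.Zmodule_isNzRing.Build Q
  pmulA pmul1l pmul1r pmulDl pmulDr p1_neq0.

Lemma pscaleA a b x : pscale a (pscale b x) = pscale (a * b) x.
Proof. by elim/presented_ind: x => ?; rewrite !pscaleE scalerA. Qed.

Lemma pscale1 : left_id 1 pscale.
Proof. by elim/presented_ind=> ?; rewrite pscaleE scale1r. Qed.

Lemma pscaleDr : right_distributive pscale +%R.
Proof.
move=> a; do 2!elim/presented_ind=> ?.
by rewrite [_ + _]paddE !pscaleE scalerDr [RHS]paddE.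
Qed.

Lemma pscaleDl x : {morph pscale^~ x : a b / a + b}.
Proof.
by move=> a b; elim/presented_ind: x => ?; rewrite !pscaleE scalerDl [RHS]paddE.
Qed.

HB.instance Definition _ := GRing.Zmodule_isLmodule.Build K Q
  pscaleA pscale1 pscaleDr pscaleDl.

Lemma pscaleAl a (x y : Q) : a *: (x * y) = (a *: x) * y.
Proof.
elim/presented_ind: x => x; elim/presented_ind: y => y.
rewrite [_ * _]pmulE [a *: ppi x]pscaleE [LHS]pscaleE [RHS]pmulE.
by rewrite scalerAl.
Qed.

HB.instance Definition _ := GRing.Lmodule_isLalgebra.Build K Q pscaleAl.

Lemma pscaleAr a (x y : Q) : a *: (x * y) = x * (a *: y).
Proof.
elim/presented_ind: x => x; elim/presented_ind: y => y.
rewrite [_ * _]pmulE [a *: ppi y]pscaleE [LHS]pscaleE [RHS]pmulE.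
by rewrite scalerAr.
Qed.

HB.instance Definition _ := GRing.Lalgebra_isAlgebra.Build K Q pscaleAr.


End Structure.

End Presented.

(* -------------------------------------------------------------------- *)

(* The free algebra on X: a copy of {malg K[{fmonom X}]}, which monalg     *)
(* makes an [lalgType] only.  The product is locked because conversion    *)
(* tends to unfold it.                                                   *)
Record free_alg (K : fieldType) (X : choiceType) :=
  FreeAlg { free_val : {malg K[{fmonom X}]} }.

HB.lock Definition free_mul (K : fieldType) (X : choiceType)
  (x y : free_alg K X) : free_alg K X := FreeAlg (free_val x * free_val y).

Section FreeAlgebra.
Variables (K : fieldType) (X : choiceType).
Local Notation F := (free_alg K X).

HB.instance Definition _ := [isNew for @free_val K X].
HB.instance Definition _ := [Choice of F by <:].

Lemma free_valP (x y : F) : free_val x = free_val y -> x = y.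
Proof. exact: val_inj. Qed.

Definition free_add (x y : F) : F := FreeAlg (free_val x + free_val y).
Definition free_opp (x : F) : F := FreeAlg (- free_val x).
Definition free_scale (a : K) (x : F) : F := FreeAlg (a *: free_val x).

Lemma free_addA : associative free_add.
Proof. by move=> x y z; apply: free_valP; apply: addrA. Qed.

Lemma free_addC : commutative free_add.
Proof. by move=> x y; apply: free_valP; apply: addrC. Qed.

Lemma free_add0 : left_id (FreeAlg 0) free_add.
Proof. by move=> x; apply: free_valP; apply: add0r. Qed.

Lemma free_addN : left_inverse (FreeAlg 0) free_opp free_add.
Proof. by move=> x; apply: free_valP; apply: addNr. Qed.

HB.instance Definition _ := GRing.isZmodule.Build F
  free_addA free_addC free_add0 free_addN.

Lemma free_mulA : associative (@free_mul K X).
Proof.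
by move=> x y z; apply: free_valP; rewrite free_mul.unlock /= mulrA.
Qed.

Lemma free_mul1l : left_id (FreeAlg 1) (@free_mul K X).
Proof. by move=> x; apply: free_valP; rewrite free_mul.unlock /= mul1r. Qed.

Lemma free_mul1r : right_id (FreeAlg 1) (@free_mul K X).
Proof. by move=> x; apply: free_valP; rewrite free_mul.unlock /= mulr1. Qed.

Lemma free_mulDl : left_distributive (@free_mul K X) +%R.
Proof.
by move=> x y z; apply: free_valP; rewrite free_mul.unlock /= mulrDl.
Qed.

Lemma free_mulDr : right_distributive (@free_mul K X) +%R.
Proof.
by move=> x y z; apply: free_valP; rewrite free_mul.unlock /= mulrDr.
Qed.

Lemma free_1_neq0 : FreeAlg 1 != 0 :> F.
Proof. by apply/eqP => /(congr1 (@free_val K X)) /eqP; rewrite oner_eq0. Qed.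

HB.instance Definition _ := GRing.Zmodule_isNzRing.Build F
  free_mulA free_mul1l free_mul1r free_mulDl free_mulDr free_1_neq0.

Lemma free_scaleA a b x : free_scale a (free_scale b x) = free_scale (a * b) x.
Proof. by apply: free_valP; apply: scalerA. Qed.

Lemma free_scale1 : left_id 1 free_scale.
Proof. by move=> x; apply: free_valP; apply: scale1r. Qed.

Lemma free_scaleDr : right_distributive free_scale +%R.
Proof. by move=> a x y; apply: free_valP; apply: scalerDr. Qed.

Lemma free_scaleDl x : {morph free_scale^~ x : a b / a + b}.
Proof. by move=> a b; apply: free_valP; apply: scalerDl. Qed.

HB.instance Definition _ := GRing.Zmodule_isLmodule.Build K F
  free_scaleA free_scale1 free_scaleDr free_scaleDl.

Lemma free_valM (x y : F) : free_val (x * y) = free_val x * free_val y.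
Proof. by rewrite [x * y]/GRing.mul /= free_mul.unlock. Qed.

Lemma free_scalerAl (a : K) (x y : F) : a *: (x * y) = (a *: x) * y.
Proof.
apply: free_valP; rewrite free_valM.
rewrite -[LHS]/(a *: free_val (x * y)) free_valM.
exact: (@scalerAl K {malg K[{fmonom X}]}).
Qed.

HB.instance Definition _ := GRing.Lmodule_isLalgebra.Build K F free_scalerAl.

Lemma free_scalerAr (a : K) (x y : F) : a *: (x * y) = x * (a *: y).
Proof.
apply: free_valP; rewrite free_valM.
rewrite -[LHS]/(a *: free_val (x * y)) free_valM.
rewrite -[free_val (a *: y)]/(a *: free_val y).
have C (z : {malg K[{fmonom X}]}) : z * a%:MP = a%:MP * z.
  rewrite mul_malgC malgM_def malgZ_def fgmulgU; apply: eq_bigr => k _.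
  by rewrite mulm1 mulrC.
by rewrite -2!mul_malgC !mulrA C.
Qed.

HB.instance Definition _ := GRing.Lalgebra_isAlgebra.Build K F free_scalerAr.

End FreeAlgebra.

HB.lock Definition fgen (K : fieldType) (X : choiceType) (x : X) :
  free_alg K X := FreeAlg << fmu x >>.
Arguments fgen {K X} x.

Section FreeEval.
Variables (K : fieldType) (X : choiceType).
Variable h : X -> K.

Definition word_val (m : {fmonom X}) : K := \prod_(x <- (m : seq X)) h x.

Lemma word_val_mmorphism : mmorphism word_val.
Proof.
split=> [x y|]; rewrite /word_val; first by rewrite fmM big_cat.
by rewrite fm1 big_nil.
Qed.
HB.instance Definition _ :=
  isMultiplicative.Build {fmonom X} K word_val word_val_mmorphism.

Definition free_eval : free_alg K X -> K^o :=
  fun x => mmap idfun word_val (free_val x).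

Lemma free_eval_additive : zmod_morphism free_eval.
Proof. by move=> x y; apply: (raddfB (mmap idfun word_val)). Qed.

HB.instance Definition _ :=
  GRing.isZmodMorphism.Build (free_alg K X) K^o free_eval free_eval_additive.

Lemma free_eval_monoid : monoid_morphism free_eval.
Proof.
split; first exact: (rmorph1 (mmap idfun word_val)).
by move=> x y; rewrite /free_eval free_valM; apply: (rmorphM (mmap idfun word_val)).
Qed.

HB.instance Definition _ :=
  GRing.isMonoidMorphism.Build (free_alg K X) K^o free_eval free_eval_monoid.

Lemma free_eval_gen x : free_eval (fgen x) = h x.
Proof. by rewrite fgen.unlock /free_eval mmapU mul1r /word_val fmU big_seq1. Qed.

Lemma free_evalZ a x : free_eval (a *: x) = a * free_eval x.
Proof. by rewrite /free_eval mmapZ. Qed.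

End FreeEval.

(* -------------------------------------------------------------------- *)

(* [sl] is sl_n (type A_{n-1}), [so_odd] is so_{2n+1} (type B_n), [sp]   *)
(* is sp_{2n} (type C_n) and [so_even] is so_{2n} (type D_n).            *)
Inductive lie_type := sl | so_odd | sp | so_even.

Definition admissible (t : lie_type) (n : nat) : bool :=
  match t with so_even => (4 <= n)%N | _ => (2 <= n)%N end.

Definition lie_rank (t : lie_type) (n : nat) : nat :=
  match t with sl => n.-1 | _ => n end.

Record node (t : lie_type) (n : nat) := Node {
  label :> nat;
  labelP : (1 <= label <= lie_rank t n)%N
}.
HB.instance Definition _ t n := [isSub for @label t n].
HB.instance Definition _ t n := [Choice of node t n by <:].

(* All roots lie in the lattice spanned by the orthonormal basis          *)
(* eps_1, ..., eps_n, so integer coordinates suffice.                     *)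
Definition eps (n j : nat) : 'rV[int]_n := \row_(k < n) (k.+1 == j)%:Z.

Definition ip (n : nat) (x y : 'rV[int]_n) : int := \sum_k x 0 k * y 0 k.

Definition alpha (t : lie_type) (n i : nat) : 'rV[int]_n :=
  if (i < n)%N then eps n i - eps n i.+1 else
  match t with
  | sl => 0
  | so_odd => eps n n
  | sp => eps n n *+ 2
  | so_even => eps n n.-1 + eps n n
  end.

Definition cartan (t : lie_type) (n i j : nat) : rat :=
  (2 * ip (alpha t n i) (alpha t n j))%:Q / (ip (alpha t n i) (alpha t n i))%:Q.

Section QuantumGroup.
Variables (K : fieldType) (r s : K) (t : lie_type) (n : nat).

(* K = Q(r,s), with r, s either two indeterminates or nonzero complex     *)
(* numbers with r^2 <> s^2.                                               *)
Definition eval2 (P : {poly {poly rat}}) : K :=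
  (map_poly (fun c : {poly rat} => (map_poly ratr c).[r]) P).[s].

Definition two_parameter_field : Prop :=
  (forall x : K, exists P Q, eval2 Q <> 0 /\ x = eval2 P / eval2 Q) /\
  ((forall P, eval2 P = 0 -> P = 0) \/
   (exists R : realType, inhabited {rmorphism K -> complex R}) /\
   r <> 0 /\ s <> 0 /\ r ^+ 2 <> s ^+ 2).

(* (alpha_i, alpha_i) is even in types A, C and D. *)
Definition norm_exp (i : nat) : int :=
  let N := ip (alpha t n i) (alpha t n i) in
  match t with so_odd => N | _ => (N %/ 2)%Z end.

Definition r_ (i : nat) : K := r ^ norm_exp i.
Definition s_ (i : nat) : K := s ^ norm_exp i.

Definition p_ (i j : nat) : K :=
  let e k := ip (eps n k) (alpha t n i) in
  match t with
  | sl => r ^ e j * s ^ e j.+1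
  | so_odd =>
      if (j < n)%N then r ^ (2 * e j) * s ^ (2 * e j.+1)
      else if (i < n)%N then r ^ (2 * e n) else r * s^-1
  | sp =>
      if (j < n)%N then r ^ e j * s ^ e j.+1
      else if (i < n)%N then r ^ (2 * e n) else r ^+ 2 * s ^- 2
  | so_even =>
      if (j < n)%N then r ^ e j * s ^ e j.+1
      else if i != n.-1 then r ^ e n.-1 * s ^ (- e n) else r^-1 * s^-1
  end.

Let I := node t n.

(* The left-hand sides of the Serre relations (whose right-hand sides are *)
(* 0), as formal linear combinations of words in I.                       *)
Definition wcomb := seq (K * seq I).

Definition commutator (i j : I) : wcomb :=
  [:: (1, [:: i; j]); (-1, [:: j; i])].

Definition cubic (i j : I) (a b : K) : wcomb :=
  [:: (1, [:: i; i; j]); (- (a + b), [:: i; j; i]); (a * b, [:: j; i; i])].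

Definition quartic (i j : I) (a b : K) : wcomb :=
  let c := a ^+ 2 + a * b + b ^+ 2 in
  [:: (1, [:: i; i; i; j]); (- c, [:: i; i; j; i]);
      (a * b * c, [:: i; j; i; i]); (- (a * b) ^+ 3, [:: j; i; i; i])].

Inductive serre : wcomb -> Prop :=
| SerreABC0 (i j : I) : t <> so_even -> (i.+1 < j)%N || (j.+1 < i)%N ->
    serre (commutator i j)
| SerreD0 (i j : I) : t = so_even -> i <> j -> cartan t n i j = 0 ->
    ~ (i = n.-1 :> nat /\ j = n :> nat) -> ~ (i = n :> nat /\ j = n.-1 :> nat) ->
    serre (commutator i j)
| SerreDlast (i j : I) : t = so_even -> i = n.-1 :> nat -> j = n :> nat ->
    serre [:: (1, [:: i; j]); (- (r * s), [:: j; i])]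
| SerreAD1 (i j : I) : t = sl \/ t = so_even -> (i < j)%N ->
    cartan t n i j = -1 -> serre (cubic i j r s)
| SerreAD2 (i j : I) : t = sl \/ t = so_even -> (i < j)%N ->
    cartan t n i j = -1 -> serre (cubic j i r^-1 s^-1)
| SerreB1 (i j : I) : t = so_odd -> (i < n)%N -> j = i.+1 :> nat ->
    serre (cubic i j (r_ i) (s_ i))
| SerreB2 (i j : I) : t = so_odd -> (j < n.-1)%N -> i = j.+1 :> nat ->
    serre (cubic i j (r_ i)^-1 (s_ i)^-1)
| SerreB3 (i j : I) : t = so_odd -> i = n :> nat -> j = n.-1 :> nat ->
    serre (quartic i j r^-1 s^-1)
| SerreC1 (i j : I) : t = sp -> (i < n.-1)%N -> j = i.+1 :> nat ->
    serre (cubic i j r s)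
| SerreC2 (i j : I) : t = sp -> (i < n.-1)%N -> j = i.+1 :> nat ->
    serre (cubic j i r^-1 s^-1)
| SerreC3 (i j : I) : t = sp -> i = n.-1 :> nat -> j = n :> nat ->
    serre (quartic i j r s)
| SerreC4 (i j : I) : t = sp -> i = n :> nat -> j = n.-1 :> nat ->
    serre (cubic i j (r ^- 2) (s ^- 2)).

Inductive Ugen :=
  GE of I | GF of I | GW of I | GWinv of I | GW' of I | GW'inv of I.
HB.instance Definition _ := gen_eqMixin Ugen.
HB.instance Definition _ := gen_choiceMixin Ugen.

Local Notation FU := (free_alg K Ugen).

Definition word_eval (x : I -> FU) (L : wcomb) : FU :=
  \sum_(cw <- L) cw.1 *: \prod_(i <- cw.2) x i.

Definition wrev (L : wcomb) : wcomb := [seq (cw.1, rev cw.2) | cw <- L].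

Definition torus_gen (x : Ugen) : bool :=
  match x with GE _ | GF _ => false | _ => true end.

Local Notation e i := (fgen (GE i)).
Local Notation f i := (fgen (GF i)).
Local Notation w i := (fgen (GW i)).
Local Notation wV i := (fgen (GWinv i)).
Local Notation w' i := (fgen (GW' i)).
Local Notation w'V i := (fgen (GW'inv i)).

Inductive Urel : FU -> FU -> Prop :=
| RelTorus x y : torus_gen x -> torus_gen y ->
    Urel (fgen x * fgen y) (fgen y * fgen x)
| RelInv i : Urel (w i * wV i) 1
| RelInv' i : Urel (w' i * w'V i) 1
| RelWE i j : Urel (w j * e i * wV j) (p_ i j *: e i)
| RelWF i j : Urel (w j * f i * wV j) ((p_ i j)^-1 *: f i)
| RelW'E i j : Urel (w' j * e i * w'V j) ((p_ j i)^-1 *: e i)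
| RelW'F i j : Urel (w' j * f i * w'V j) (p_ j i *: f i)
| RelEF i j : Urel (e i * f j - f j * e i)
    (if i == j then (r_ i - s_ i)^-1 *: (w i - w' i) else 0)
| RelSerreE L : serre L -> Urel (word_eval (fun i => e i) L) 0
| RelSerreF L : serre L -> Urel (word_eval (fun i => f i) (wrev L)) 0.

(* 1 is not in the ideal: the algebra morphism to K that sends e_i, f_i   *)
(* to 0 and the other generators to 1 vanishes on it.                    *)
Definition eps_gen (x : Ugen) : K := (torus_gen x)%:R.
Local Notation eps_free := (free_eval eps_gen).

Lemma serre_words L : serre L -> all (fun cw => cw.2 != [::]) L.
Proof. by case. Qed.

Lemma eps_free_word (x : I -> Ugen) L :
  (forall i, ~~ torus_gen (x i)) -> all (fun cw => cw.2 != [::]) L ->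
  eps_free (word_eval (fun i => fgen (x i)) L) = 0.
Proof.
move=> xP /allP LP; rewrite /word_eval rmorph_sum big_seq big1 // => cw /LP.
case: cw.2 => // i v _; rewrite [LHS]free_evalZ big_cons rmorphM /= free_eval_gen.
by rewrite /eps_gen (negbTE (xP i)) mul0r mulr0.
Qed.

Lemma eps_free_rel x y : Urel x y -> eps_free x = eps_free y.
Proof.
case=> [{}x {}y _ _|i|i|i j|i j|i j|i j|i j|L LP|L LP].
- by rewrite 2!rmorphM [RHS]mulrC.
- by rewrite rmorphM rmorph1 /= !free_eval_gen mulr1.
- by rewrite rmorphM rmorph1 /= !free_eval_gen mulr1.
- by rewrite free_evalZ 2!rmorphM /= !free_eval_gen !mulr1 !mulr0.
- by rewrite free_evalZ 2!rmorphM /= !free_eval_gen !mulr1 !mulr0.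
- by rewrite free_evalZ 2!rmorphM /= !free_eval_gen !mulr1 !mulr0.
- by rewrite free_evalZ 2!rmorphM /= !free_eval_gen !mulr1 !mulr0.
- rewrite rmorphB 2!rmorphM /= !free_eval_gen !mulr0 subr0.
  case: eqP => _; last by rewrite rmorph0.
  by rewrite free_evalZ rmorphB /= !free_eval_gen subrr mulr0.
- by rewrite rmorph0 eps_free_word //; apply: serre_words.
- rewrite rmorph0 eps_free_word //; rewrite all_map.
  apply: sub_all (serre_words LP) => -[c v] /=.
  by rewrite -!size_eq0 size_rev.
Qed.

Lemma eps_free_ideal x : ideal Urel x -> eps_free x = 0.
Proof.
elim=> [|{}x y _ IHx _ IHy|a b {}x y xy]; first by rewrite rmorph0.
  by rewrite rmorphD /= IHx IHy addr0.
by rewrite !rmorphM rmorphB /= (eps_free_rel xy) subrr mulr0 mul0r.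
Qed.

Lemma Urel_proper : ~ ideal Urel 1.
Proof. by move=> /eps_free_ideal /eqP; rewrite rmorph1 oner_eq0. Qed.

(* The two-parameter quantum group U_{r,s}(g), as an algebra. *)
Definition Urs : algType K := presented Urel_proper.

Definition ugen (x : Ugen) : Urs := ppi Urel_proper (fgen x).

(* The values of the Hopf operations of U_{r,s}(g) on the generators. *)
Definition Urs_hopf_values (hU : hopf_struct Urs) : Prop :=
  (forall x, torus_gen x ->
     comul hU (ugen x) = ugen x [x] ugen x /\ counit hU (ugen x) = 1) /\
  (forall i,
     [/\ comul hU (ugen (GE i)) =
           ugen (GE i) [x] 1 + ugen (GW i) [x] ugen (GE i),
         counit hU (ugen (GE i)) = 0 &
         antip hU (ugen (GE i)) = - (ugen (GWinv i) * ugen (GE i))]) /\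
  (forall i,
     [/\ comul hU (ugen (GF i)) =
           1 [x] ugen (GF i) + ugen (GF i) [x] ugen (GW' i),
         counit hU (ugen (GF i)) = 0 &
         antip hU (ugen (GF i)) = - (ugen (GF i) * ugen (GW'inv i))]).

Inductive Bgen := BE of I | BW of I | BWinv of I.
Inductive B'gen := BF of I | BW' of I | BW'inv of I.

Definition Bgen_val (x : Bgen) : Urs :=
  match x with
  | BE i => ugen (GE i) | BW i => ugen (GW i) | BWinv i => ugen (GWinv i)
  end.

Definition B'gen_val (x : B'gen) : Urs :=
  match x with
  | BF i => ugen (GF i) | BW' i => ugen (GW' i) | BW'inv i => ugen (GW'inv i)
  end.

Definition Bplus : algType K := subalg_gen Bgen_val.
Definition Bminus : algType K := subalg_gen B'gen_val.

Definition pairing_gen (y : B'gen) (x : Bgen) : K :=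
  match y, x with
  | BF i, BE j => if i == j then (s_ i - r_ i)^-1 else 0
  | BW' i, BW j => p_ i j
  | BW' i, BWinv j => (p_ i j)^-1
  | BW'inv i, BW j => (p_ i j)^-1
  | BW'inv i, BWinv j => p_ i j
  | _, _ => 0
  end.

Definition pairing_values (phi : Bminus -> Bplus -> K) : Prop :=
  forall y x, phi (sgen B'gen_val y) (sgen Bgen_val x) = pairing_gen y x.

End QuantumGroup.

(* Main.v *)
Require Import Defs.
From mathcomp Require Import all_boot all_order all_algebra.
From mathcomp Require Import finmap boolp classical_sets monalg.

(** The isomorphism is inverse to the product map a (x) f |-> a f from
    D(B, B') to U = U_{r,s}(g).  To see that this map is bijective, let U act
    on the space B (x) B': the generators of B by left multiplication, and
    f in B' by
      f . (a (x) k) = \sum <S f1, a1> <f3, a3> a2 (x) f2 k,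
    which is left multiplication by 1 (x) f in the double.  That the latter
    is an action of B' is a general fact on skew-dual pairings, so the
    relations of U involving only e, w or only f, w' hold automatically.  The
    mixed ones follow from the values of the pairing on generators, because
    Delta f_i = 1 (x) f_i + f_i (x) w'_i makes f_i act as a skew derivation.
    The product map is U-linear for this action and a f . (1 (x) 1) =
    a (x) f, so u |-> u . (1 (x) 1) is its inverse. *)

Set Implicit Arguments.
Unset Strict Implicit.
Unset Printing Implicit Defensive.

Import GRing.Theory.
Local Open Scope ring_scope.

(** * Linear maps and tensor products *)

Section LinearMaps.
Variable K : fieldType.
Implicit Types V W X Z : lmodType K.

(** Bijectivity of the product map is the triangular decomposition of U. The obstacle is that B and
    B' are given only as subalgebras of U: no presentation of them is at hand, so no map out of B or
    B' can be defined on generators. Only U is presented, and hence the inverse is built from an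
    action of U. A relation among e, w holds for the operators because left multiplication by an
    element of B depends on that element alone; likewise for f, w'.

    The U-linearity of the product map amounts to the identity f a = \sum <S f1, a1> <f3, a3> a2 f2
    inside U. For f a generator of B' it is proved by induction on a, since both sides obey the same
    twisted Leibniz rule; it extends to all f because both sides are multiplicative in f. The same
    identity makes the product map multiplicative.

    The coproducts of B and B' are known only through their images in U (x) U. They are recovered
    from the injectivity of B (x) B -> U (x) U, which over a field follows from linear
    retractions. *)

Lemma linear_add V W (f : V -> W) : linear f -> {morph f : x y / x + y}.
Proof. by move=> fL x y; rewrite -[x in LHS]scale1r fL scale1r. Qed.

Lemma linear_zero V W (f : V -> W) : linear f -> f 0 = 0.
Proof.
by move=> fL; have := fL (-1) 0 0; rewrite scaler0 addr0 scaleN1r addNr.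
Qed.

Lemma linear_scale V W (f : V -> W) a x : linear f -> f (a *: x) = a *: f x.
Proof. by move=> fL; have := fL a x 0; rewrite (linear_zero fL) !addr0. Qed.

Lemma linear_opp V W (f : V -> W) x : linear f -> f (- x) = - f x.
Proof. by move=> fL; rewrite -scaleN1r linear_scale // scaleN1r. Qed.

Lemma linear_big_sum V W (f : V -> W) I (s : seq I) (F : I -> V) : linear f ->
  f (\sum_(i <- s) F i) = \sum_(i <- s) f (F i).
Proof.
by move=> fL; apply: (big_morph f); [exact: linear_add | exact: linear_zero].
Qed.

Lemma linear_id V : linear (fun x : V => x). Proof. by []. Qed.

Lemma linear_comp V W Z (f : W -> Z) (g : V -> W) :
  linear f -> linear g -> linear (fun x => f (g x)).
Proof. by move=> fL gL a x y; rewrite gL fL. Qed.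

Lemma linear_addf V W (f g : V -> W) :
  linear f -> linear g -> linear (fun x => f x + g x).
Proof. by move=> fL gL a x y; rewrite fL gL scalerDr addrACA. Qed.

Lemma linear_oppf V W (f : V -> W) : linear f -> linear (fun x => - f x).
Proof. by move=> fL a x y; rewrite fL opprD scalerN. Qed.

Lemma linear_mull V (A : algType K) (f : V -> A) c :
  linear f -> linear (fun x => f x * c).
Proof. by move=> fL a x y; rewrite fL mulrDl scalerAl. Qed.

Lemma linear_mulr V (A : algType K) (f : V -> A) c :
  linear f -> linear (fun x => c * f x).
Proof. by move=> fL a x y; rewrite fL mulrDr scalerAr. Qed.

Lemma linear_Kmull V (f : V -> K^o) (c : K) :
  linear f -> linear (fun x => f x * c : K^o).
Proof.
by move=> fL a x y; rewrite fL mulrDl; congr (_ + _); rewrite -mulrA.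
Qed.

Lemma linear_Kmulr V (f : V -> K^o) (c : K) :
  linear f -> linear (fun x => c * f x : K^o).
Proof. by move=> fL a x y; rewrite fL mulrDr; congr (_ + _); apply: mulrCA. Qed.

Lemma linear_scalel V W (f : V -> K^o) (w : W) :
  linear f -> linear (fun x => f x *: w).
Proof. by move=> fL a x y; rewrite fL scalerDl -scalerA. Qed.

Lemma linear_scaler V W (f : V -> W) (c : K) :
  linear f -> linear (fun x => c *: f x).
Proof. by move=> fL a x y; rewrite fL scalerDr !scalerA mulrC. Qed.

Lemma linear_purel V W X (f : V -> W) (w : X) :
  linear f -> linear (fun x => f x [x] w).
Proof.
move=> fL a x y; rewrite fL; have [_ pL] := @pure_bilinear K W X; exact: pL.
Qed.

Lemma linear_purer V W X (f : V -> W) (w : X) :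
  linear f -> linear (fun x => w [x] f x).
Proof.
move=> fL a x y; rewrite fL; have [pL _] := @pure_bilinear K X W; exact: pL.
Qed.

Lemma linear_tlift V W X Z (b : V -> W -> Z) (f : X -> tens V W) :
  bilinear_map b -> linear f -> linear (fun x => tlift b (f x)).
Proof. by move=> bP fL; apply: linear_comp fL; apply: tlift_linear. Qed.

(** For a fixed tensor [t], [tlift (b x) t] is a sum over the single representative [sumrep t], so
    linearity in [x] is checked term by term. The same remark gives [tliftE], [tlift_linearl] and
    [tlift_exchange]; bilinearity of [b] enters only when the tensor itself changes. *)
Lemma linear_tlift_fun V W X Z (b : X -> V -> W -> Z) t :
  (forall v w, linear (fun x => b x v w)) -> linear (fun x => tlift (b x) t).
Proof.
move=> bL a x y; rewrite /tlift scaler_sumr -big_split.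
by apply: eq_bigr => p _; apply: bL.
Qed.

Lemma tliftE V W Z (b : V -> W -> Z) t g :
  (forall v w, b v w = g v w) -> tlift b t = tlift g t.
Proof. by move=> bg; apply: eq_bigr => p _; apply: bg. Qed.

Lemma tlift_linearl V W Z Z' (b : V -> W -> Z) (f : Z -> Z') t :
  linear f -> f (tlift b t) = tlift (fun v w => f (b v w)) t.
Proof. exact: linear_big_sum. Qed.

Lemma tlift_exchange V W V' W' Z (F : V -> W -> V' -> W' -> Z) t t' :
  tlift (fun v w => tlift (F v w) t') t =
  tlift (fun v' w' => tlift (fun v w => F v w v' w') t) t'.
Proof. exact: exchange_big. Qed.

Lemma tens_linear_ext V W Z (f g : tens V W -> Z) : linear f -> linear g ->
  (forall v w, f (v [x] w) = g (v [x] w)) -> f =1 g.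
Proof.
move=> fL gL fg x; rewrite (pure_sumE x) !linear_big_sum //.
by apply: eq_bigr => p _.
Qed.

Lemma tlift_tlift V W V' W' Z (b : V' -> W' -> Z) (c : V -> W -> tens V' W') t :
  bilinear_map b ->
  tlift b (tlift c t) = tlift (fun v w => tlift b (c v w)) t.
Proof. by move=> bP; rewrite tlift_linearl //; apply: tlift_linear. Qed.

Lemma linear_bundled V W X (g : {linear V -> W}) (f : X -> V) :
  linear f -> linear (fun x => g (f x)).
Proof. by move=> fL a x y; rewrite fL linearP. Qed.

End LinearMaps.

(** Hook of [lin_step], redefined each time further maps (the pairing, [ract], [lact], the
    inclusions) acquire linearity lemmas. *)
Ltac lin_extra := fail.

Ltac lin_step := first
  [ lin_extra | exact: linear_id | assumption
  | lazymatch goal with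
    | |- forall _, _ => move=> ? /=
    end
  | apply: linear_tlift | apply: linear_tlift_fun
  | apply: linear_mull | apply: linear_mulr
  | apply: linear_Kmull | apply: linear_Kmulr
  | apply: linear_purel | apply: linear_purer
  | apply: linear_scalel | apply: linear_scaler
  | apply: linear_addf | apply: linear_oppf
  | apply: linear_bundled
  | lazymatch goal with |- bilinear_map _ => split end
  | match goal with
    | H : forall _, linear _ |- _ => exact: H
    | H : forall _, linear _ |- _ => apply: (linear_comp (H _))
    end ].

Ltac lin := by repeat lin_step.

(** * Sweedler calculus and the antipode *)

Section HopfTheory.
Variables (K : fieldType) (H : algType K) (hH : hopf_struct H).
Implicit Types (x y z : H) (Z : lmodType K).
Local Notation D := (comul hH).
Local Notation S := (antip hH).
Local Notation e := (counit hH).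

Definition trilinear_map Z (b : H -> H -> H -> Z) : Prop :=
  [/\ forall x y, linear (b x y), forall x z, linear (b x ^~ z) &
      forall y z, linear (fun x => b x y z)].

(** [comulA] is an equality of tensors. Applying the linear map x (x) (y (x) z) |-> b x y z to both
    sides turns it into an equality of iterated sums; trilinearity makes that map well defined. *)
Lemma comul_assoc Z (b : H -> H -> H -> Z) x : trilinear_map b ->
  tlift (fun x1 x2 => tlift (fun x11 x12 => b x11 x12 x2) (D x1)) (D x) =
  sweedler3 hH x b.
Proof.
case=> b3 b2 b1; pose B x (t : tens H H) := tlift (b x) t.
have Bb x' : bilinear_map (b x') by split=> ?; lin.
have BL : bilinear_map B.
  split=> [x' | t]; first exact: tlift_linear.
  by apply: linear_tlift_fun => ? ?; apply: b1.
have [_ aL] := BL.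
have -> : sweedler3 hH x b = tlift B (tmap id D (D x)).
  rewrite /tmap tlift_tlift //; apply: tliftE => x1 x2.
  by rewrite tlift_pure.
rewrite -comulA /tassoc /tmap.
rewrite !tlift_tlift //; [|lin..].
apply: tliftE => x1 x2; rewrite tlift_pure; last by split=> ?; lin.
rewrite tlift_tlift //; apply: tliftE => x11 x12.
by rewrite tlift_pure // /B tlift_pure.
Qed.

Lemma comul_mul Z (b : H -> H -> Z) x y : bilinear_map b ->
  tlift b (D (x * y)) =
  tlift (fun x1 x2 => tlift (fun y1 y2 => b (x1 * y1) (x2 * y2)) (D y)) (D x).
Proof.
move=> bP; rewrite comulM /tmul tlift_tlift //; apply: tliftE => x1 x2.
rewrite tlift_tlift //; apply: tliftE => y1 y2; exact: tlift_pure.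
Qed.

Lemma tlift_counitl Z (g : H -> Z) x : linear g ->
  tlift (fun x1 x2 => e x1 *: g x2) (D x) = g x.
Proof.
move=> gL; rewrite -[in RHS](counitl hH x) tlift_linearl //.
by apply: tliftE => *; rewrite linear_scale.
Qed.

Lemma tlift_counitr Z (g : H -> Z) x : linear g ->
  tlift (fun x1 x2 => e x2 *: g x1) (D x) = g x.
Proof.
move=> gL; rewrite -[in RHS](counitr hH x) tlift_linearl //.
by apply: tliftE => *; rewrite linear_scale.
Qed.

Lemma tlift_antipl Z (g : H -> Z) x : linear g ->
  tlift (fun x1 x2 => g (S x1 * x2)) (D x) = e x *: g 1.
Proof. by move=> gL; rewrite -tlift_linearl // antipl linear_scale. Qed.

Lemma tlift_antipr Z (g : H -> Z) x : linear g ->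
  tlift (fun x1 x2 => g (x1 * S x2)) (D x) = e x *: g 1.
Proof. by move=> gL; rewrite -tlift_linearl // antipr linear_scale. Qed.

Lemma antip1 : S 1 = 1.
Proof.
have := antipl hH 1; rewrite comul1 counit1 scale1r tlift_pure ?mulr1 //.
by split; lin.
Qed.

Lemma counit_antip x : e (S x) = e x.
Proof.
rewrite -[LHS](@tlift_counitr _ (fun y => e (S y) : K^o)); last lin.
have := congr1 e (antipl hH x); rewrite linearZ /= counit1 [RHS]mulr1 => <-.
rewrite (tlift_linearl _ (f := e)); last lin.
by apply: tliftE => x1 x2; rewrite counitM; apply: mulrC.
Qed.

(* Both sides are convolution inverses of the product: the expression     *)
(* \sum S(x1 y1) x2 y2 S(y3) S(x3) collapses to either of them.           *)
Lemma antipM x y : S (x * y) = S y * S x.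
Proof.
pose F x1 x2 x3 := sweedler3 hH y (fun y1 y2 y3 =>
  S (x1 * y1) * (x2 * (y2 * S y3) * S x3)).
have FL : trilinear_map F by rewrite /F /sweedler3; split; lin.
transitivity (sweedler3 hH x F).
  have FE x1 x2 x3 : F x1 x2 x3 = S (x1 * y) * (x2 * S x3).
    rewrite -(@tlift_counitr _ (fun y1 => S (x1 * y1) * (x2 * S x3))); last lin.
    apply: tliftE => y1 y2.
    by rewrite (@tlift_antipr _ (fun z => S (x1 * y1) * (x2 * z * S x3)))
      ?mulr1 //; lin.
  rewrite -(@tlift_counitr _ (fun x1 => S (x1 * y))); last lin.
  apply: tliftE => x1 x2; under tliftE do rewrite FE.
  by rewrite (@tlift_antipr _ (fun z => S (x1 * y) * z)) ?mulr1 //; lin.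
rewrite -comul_assoc //.
have FE x3 x12 : tlift (fun x1 x2 => F x1 x2 x3) (D x12) =
  e x12 *: (S y * S x3).
  rewrite /F.
  under tliftE => x1 x2.
    rewrite -comul_assoc; last by split; lin.
    over.
  rewrite tlift_exchange.
  rewrite -(@tlift_counitl _ (fun z => e x12 *: (S z * S x3)) y); last lin.
  apply: tliftE => y12 y3; rewrite tlift_exchange.
  rewrite scalerA mulrC -scalerA.
  have -> : e x12 *: (e y12 *: (S y3 * S x3)) =
    e (x12 * y12) *: (1 * S y3 * S x3) by rewrite counitM scalerA mul1r.
  rewrite -(@tlift_antipl _ (fun z => z * S y3 * S x3)); last lin.
  rewrite comul_mul; last by split; lin.
  rewrite tlift_exchange; apply: tliftE => x1 x2; apply: tliftE => y1 y2.
  by rewrite !mulrA.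
under tliftE do rewrite FE.
by rewrite (@tlift_counitl _ (fun z => S y * S z)) //; lin.
Qed.

End HopfTheory.

(** * Tensor products of injective linear maps *)

Section Retraction.
Variable K : fieldType.
Local Open Scope classical_set_scope.

(* Zorn's lemma provides a complement of the image. *)
Lemma linear_retraction (V U : lmodType K) (i : V -> U) :
  linear i -> injective i -> exists2 p : U -> V, linear p & cancel i p.
Proof.
move=> iL iI.
pose P (C : set U) := (forall a x y, C x -> C y -> C (a *: x + y)) /\
  (forall v, C (i v) -> v = 0).
have [C [[CL C0] Cmax]] : exists C, P C /\ forall C', C `<` C' -> ~ P C'.
  apply: Zorn_bigcup => F FP Ftot;
    split=> [a x y [X FX Xx] [Y FY Yy]|v [X FX Xv]].
    have [XY|YX] := Ftot _ _ FX FY.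
      by exists Y => //; apply: (FP _ FY).1 => //; apply: XY.
    by exists X => //; apply: (FP _ FX).1 => //; apply: YX.
  exact: (FP _ FX).2 Xv.
have iinj v : i v = 0 -> v = 0.
  by move=> iv0; apply: iI; rewrite iv0 linear_zero.
(* [P] does not ask for 0, so that it holds for the union of the empty chain; maximality is what
   puts 0 into [C]. *)
have C00 : C 0.
  apply: contrapT => nC0; apply: (Cmax (C `|` [set 0])).
    by split=> [x|sub]; [left | apply/nC0/sub; right].
  split=> [a x y|v]; last by case=> [/C0 //|/iinj].
  case=> [Cx|->]; case=> [Cy|->].
  - by left; apply: CL.
  - have CN : C (-1 *: x + x) by apply: CL.
    by rewrite scaleN1r addNr in CN.
  - by rewrite scaler0 add0r; left.
  - by rewrite scaler0 addr0; right.
have CZ a x : C x -> C (a *: x) by move=> Cx; rewrite -[_ *: _]addr0; apply: CL.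
have CD x y : C x -> C y -> C (x + y).
  by move=> Cx Cy; rewrite -(scale1r x); apply: CL.
have dec u : exists v, C (u - i v).
  apply: contrapT => nu.
  (* The set is C + K u. If it contains i v with a nonzero coefficient a on u, then u - i (a^-1 v)
     lies in C; otherwise it contradicts maximality. *)
  apply: (Cmax [set x | exists a, C (x - a *: u)]).
    split=> [x Cx /=|sub]; first by exists 0; rewrite scale0r subr0.
    apply: nu; exists 0; rewrite (linear_zero iL) subr0.
    by apply: sub; exists 1; rewrite scale1r subrr.
  split=> [a x y [b Cx] [c Cy] /=|v [a Cv]].
    exists (a * b + c).
    have -> : a *: x + y - (a * b + c) *: u = a *: (x - b *: u) + (y - c *: u).
      by rewrite scalerDl scalerBr scalerA opprD addrACA.
    exact: CL.
  have [a0|a0] := eqVneq a 0.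
    by apply: C0; move: Cv; rewrite a0 scale0r subr0.
  case: nu; exists (a^-1 *: v).
  have -> : u - i (a^-1 *: v) = (- a^-1) *: (i v - a *: u).
    by rewrite scalerBr scalerA mulNr mulVf // scaleN1r opprK addrC
      linear_scale // scaleNr.
  exact: CZ.
pose p u := projT1 (cid (dec u)).
have pP u : C (u - i (p u)) by rewrite /p; case: cid.
have uniq u v : C (u - i v) -> p u = v.
  move=> Cv; apply/eqP; rewrite -subr_eq0; apply/eqP/C0.
  rewrite linear_add // linear_opp //.
  have -> : i (p u) - i v = (-1) *: (u - i (p u)) + (u - i v).
    by rewrite scaleN1r opprB subrKA.
  exact: CL.
exists p => [a x y|v]; apply: uniq; last by rewrite subrr.
rewrite iL opprD addrACA -scalerBr; exact: CL.
Qed.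

(** If p and q are retractions of f and g, then p (x) q is a left inverse of f (x) g. This is what
    allows coproducts of B and B' to be compared inside U (x) U. *)
Lemma tmap_inj (V V' W W' : lmodType K) (f : V -> V') (g : W -> W') :
  linear f -> injective f -> linear g -> injective g -> injective (tmap f g).
Proof.
move=> fL fI gL gI.
have [p pL pK] := linear_retraction fL fI.
have [q qL qK] := linear_retraction gL gI.
have b0 : bilinear_map (fun v w => f v [x] g w).
  split=> [v|w]; first by apply: linear_purer.
  by apply: linear_purel.
have b1 : bilinear_map (fun v w => p v [x] q w).
  split=> [v|w]; first by apply: linear_purer.
  by apply: linear_purel.
apply: (@can_inj _ _ _ (tmap p q)) => x; rewrite /tmap tlift_tlift //.
rewrite [RHS](pure_sumE x); apply: eq_bigr => vw _.
by rewrite tlift_pure // pK qK.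
Qed.

End Retraction.

(** * Actions attached to a skew-dual pairing *)

Section DoubleAction.
Variables (K : fieldType) (A U : algType K).
Variables (hA : hopf_struct A) (hU : hopf_struct U) (phi : U -> A -> K).
Hypothesis phiP : skew_dual_pairing hA hU phi.
Implicit Types (a b : A) (f g k : U).

Lemma linear_phil (V : lmodType K) (h : V -> U) a :
  linear h -> linear (fun x => phi (h x) a : K^o).
Proof. by have [_ [phiL _]] := phiP => hL c x y; rewrite hL phiL. Qed.

Lemma linear_phir (V : lmodType K) (h : V -> A) f :
  linear h -> linear (fun x => phi f (h x) : K^o).
Proof. by have [phiL _] := phiP => hL c x y; rewrite hL phiL. Qed.

Ltac lin_extra ::= first [apply: linear_phil | apply: linear_phir].

Lemma phif1 f : phi f 1 = counit hU f. Proof. by case: phiP => _ [_ []]. Qed.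

Lemma phi1a a : phi 1 a = counit hA a.
Proof. by case: phiP => _ [_ [_ []]]. Qed.

Lemma phifM f a b :
  phi f (a * b) = tlift (fun f1 f2 => phi f2 a * phi f1 b : K^o) (comul hU f).
Proof. by case: phiP => _ [_ [_ [_ []]]]. Qed.

Lemma phiMa f g a :
  phi (f * g) a = tlift (fun a1 a2 => phi f a1 * phi g a2 : K^o) (comul hA a).
Proof. by case: phiP => _ [_ [_ [_ []]]]. Qed.

(* <f, a2> a1 and <f, a1> a2: commuting left and right actions of U on A. *)
Definition ract f a : A := tlift (fun a1 a2 => phi f a2 *: a1) (comul hA a).
Definition lact f a : A := tlift (fun a1 a2 => phi f a1 *: a2) (comul hA a).

Lemma linear_ractl (V : lmodType K) (h : V -> U) a :
  linear h -> linear (fun x => ract (h x) a).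
Proof. by rewrite /ract => ?; lin. Qed.

Lemma linear_ractr (V : lmodType K) (h : V -> A) f :
  linear h -> linear (fun x => ract f (h x)).
Proof. by rewrite /ract => ?; lin. Qed.

Lemma linear_lactl (V : lmodType K) (h : V -> U) a :
  linear h -> linear (fun x => lact (h x) a).
Proof. by rewrite /lact => ?; lin. Qed.

Lemma linear_lactr (V : lmodType K) (h : V -> A) f :
  linear h -> linear (fun x => lact f (h x)).
Proof. by rewrite /lact => ?; lin. Qed.

Ltac lin_extra ::= first
  [ apply: linear_phil | apply: linear_phir | apply: linear_ractl
  | apply: linear_ractr | apply: linear_lactl | apply: linear_lactr ].

Lemma ractM f g a : ract (f * g) a = ract f (ract g a).
Proof.
pose b (x y z : A) := phi g z *: (phi f y *: x).
transitivity (sweedler3 hA a b).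
  apply: tliftE => a1 a23; rewrite phiMa.
  rewrite (tlift_linearl _ (f := fun c : K^o => c *: a1)); last lin.
  by apply: tliftE => a2 a3; rewrite /b scalerA mulrC.
rewrite -comul_assoc /b; last by split; lin.
rewrite [ract g a]/ract (tlift_linearl _ (f := ract f)); last lin.
apply: tliftE => a1 a2; rewrite (linear_scale (f := ract f)); last lin.
by rewrite (tlift_linearl _ (f := fun z => phi g a2 *: z)); last lin.
Qed.

Lemma lactM f g a : lact (f * g) a = lact g (lact f a).
Proof.
pose b (x y z : A) := phi f x *: (phi g y *: z).
transitivity (sweedler3 hA a b).
  rewrite -comul_assoc /b; last by split; lin.
  apply: tliftE => a12 a3; rewrite phiMa.
  rewrite (tlift_linearl _ (f := fun c : K^o => c *: a3)); last lin.
  by apply: tliftE => a1 a2; rewrite scalerA.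
rewrite [lact f a]/lact (tlift_linearl _ (f := lact g)); last lin.
apply: tliftE => a1 a2; rewrite (linear_scale (f := lact g)); last lin.
by rewrite (tlift_linearl _ (f := fun z => phi f a1 *: z)); last lin.
Qed.

(** The right-hand side is the sum over a' in [double_mul], which is how the product of the double
    is expressed by the two actions in [double_mulE]. *)
Lemma lact_ractE f g a : lact f (ract g a) =
  sweedler3 hA a (fun a1 a2 a3 => phi f a1 * phi g a3 *: a2).
Proof.
rewrite -comul_assoc; last by split; lin.
rewrite [ract g a]/ract (tlift_linearl _ (f := lact f)); last lin.
apply: tliftE => a1 a2; rewrite (linear_scale (f := lact f)); last lin.
rewrite (tlift_linearl _ (f := fun z => phi g a2 *: z)); last lin.
by apply: tliftE => a11 a12; rewrite scalerA mulrC.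
Qed.

Lemma lact_ract f g a : lact f (ract g a) = ract g (lact f a).
Proof.
rewrite lact_ractE [lact f a]/lact (tlift_linearl _ (f := ract g)); last lin.
apply: tliftE => a1 a2; rewrite (linear_scale (f := ract g)); last lin.
rewrite (tlift_linearl _ (f := fun z => phi f a1 *: z)); last lin.
by apply: tliftE => a11 a12; rewrite scalerA.
Qed.

(** Delta is multiplicative on A, and f pairs with a product through the opposite coproduct; hence
    f2 meets the first factor. For f = f_i this becomes the skew derivation rule [ract_skew_mul]. *)
Lemma ract_mul f a b :
  ract f (a * b) = tlift (fun f1 f2 => ract f2 a * ract f1 b) (comul hU f).
Proof.
rewrite {1}/ract comul_mul; last by split; lin.
under [RHS]tliftE => f1 f2.
  rewrite [ract f2 a]/ract (tlift_linearl _ (f := fun z => z * _)); last lin.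
  under tliftE => a1 a2.
    rewrite [ract f1 b]/ract (tlift_linearl _ (f := fun z => _ * z)); last lin.
    over.
  over.
rewrite [RHS]tlift_exchange; apply: tliftE => a1 a2.
rewrite [RHS]tlift_exchange; apply: tliftE => b1 b2.
rewrite phifM (tlift_linearl _ (f := fun c : K^o => c *: (a1 * b1))); last lin.
by apply: tliftE => f1 f2; rewrite -scalerAl -scalerAr scalerA.
Qed.

Lemma lact_mul f a b :
  lact f (a * b) = tlift (fun f1 f2 => lact f2 a * lact f1 b) (comul hU f).
Proof.
rewrite {1}/lact comul_mul; last by split; lin.
under [RHS]tliftE => f1 f2.
  rewrite [lact f2 a]/lact (tlift_linearl _ (f := fun z => z * _)); last lin.
  under tliftE => a1 a2.
    rewrite [lact f1 b]/lact (tlift_linearl _ (f := fun z => _ * z)); last lin.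
    over.
  over.
rewrite [RHS]tlift_exchange; apply: tliftE => a1 a2.
rewrite [RHS]tlift_exchange; apply: tliftE => b1 b2.
rewrite phifM (tlift_linearl _ (f := fun c : K^o => c *: (a2 * b2))); last lin.
by apply: tliftE => f1 f2; rewrite -scalerAl -scalerAr scalerA.
Qed.

Lemma ract_1 a : ract 1 a = a.
Proof.
rewrite -[RHS](tlift_counitr hA (g := id) a) //.
by apply: tliftE => *; rewrite phi1a.
Qed.

Lemma lact_1 a : lact 1 a = a.
Proof.
rewrite -[RHS](tlift_counitl hA (g := id) a) //.
by apply: tliftE => *; rewrite phi1a.
Qed.

Lemma ract1 f : ract f 1 = counit hU f *: 1.
Proof. by rewrite /ract comul1 tlift_pure ?phif1 //; split; lin. Qed.

Lemma lact1 f : lact f 1 = counit hU f *: 1.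
Proof. by rewrite /lact comul1 tlift_pure ?phif1 //; split; lin. Qed.

Definition lmul a : tens A U -> tens A U :=
  tlift (fun a' k => (a * a') [x] k).

Definition dact f : tens A U -> tens A U :=
  tlift (fun a k => sweedler3 hU f (fun f1 f2 f3 =>
    lact (antip hU f1) (ract f3 a) [x] (f2 * k))).

Lemma lmul_bilinear a :
  bilinear_map (fun a' k => (a * a') [x] k : tens A U).
Proof. by split; lin. Qed.

Lemma dact_bilinear f :
  bilinear_map (fun a k => sweedler3 hU f (fun f1 f2 f3 =>
    lact (antip hU f1) (ract f3 a) [x] (f2 * k))).
Proof. by rewrite /sweedler3; split; lin. Qed.

Lemma lmul_linear a : linear (lmul a).
Proof. exact/tlift_linear/lmul_bilinear. Qed.

Lemma dact_linear f : linear (dact f).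
Proof. exact/tlift_linear/dact_bilinear. Qed.

Lemma lmul_pure a a' k : lmul a (a' [x] k) = (a * a') [x] k.
Proof. exact/tlift_pure/lmul_bilinear. Qed.

Lemma dact_pure f a k : dact f (a [x] k) =
  sweedler3 hU f (fun f1 f2 f3 =>
    lact (antip hU f1) (ract f3 a) [x] (f2 * k)).
Proof. exact/tlift_pure/dact_bilinear. Qed.

Lemma lmul_linearl x : linear (lmul^~ x).
Proof. by rewrite /lmul; lin. Qed.

Lemma dact_linearl x : linear (dact^~ x).
Proof. by rewrite /dact /sweedler3; lin. Qed.

Lemma lmulM a b x : lmul (a * b) x = lmul a (lmul b x).
Proof.
apply: (tens_linear_ext (f := lmul _) (g := fun x => lmul a (lmul b x))).
- exact: lmul_linear.
- by apply: linear_comp; apply: lmul_linear.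
by move=> a' k; rewrite !lmul_pure mulrA.
Qed.

Lemma lmul1 x : lmul 1 x = x.
Proof.
apply: (tens_linear_ext (f := lmul _) (g := id)) => //;
  first exact: lmul_linear.
by move=> a' k; rewrite !lmul_pure mul1r.
Qed.

(** The antipode reverses products and [lact] is a right action, so f |-> lact (S f) is a left
    action. It commutes with [ract], and Delta (f g) = Delta f Delta g, so both sides agree after
    reordering the sums. *)
Lemma dactM f g x : dact (f * g) x = dact f (dact g x).
Proof.
apply: (tens_linear_ext (f := dact _) (g := fun x => dact f (dact g x))).
- exact: dact_linear.
- by apply: linear_comp; apply: dact_linear.
move=> a k; rewrite !dact_pure.
have RE : dact f (sweedler3 hU g (fun g1 g2 g3 =>
    lact (antip hU g1) (ract g3 a) [x] (g2 * k))) =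
  tlift (fun g1 g23 => tlift (fun g2 g3 => tlift (fun f1 f23 =>
    tlift (fun f2 f3 => lact (antip hU f1) (ract f3 (lact (antip hU g1)
      (ract g3 a))) [x] (f2 * (g2 * k))) (comul hU f23)) (comul hU f))
    (comul hU g23)) (comul hU g).
  rewrite (tlift_linearl _ (f := dact f)); last exact: dact_linear.
  apply: tliftE => g1 g23.
  rewrite (tlift_linearl _ (f := dact f)); last exact: dact_linear.
  by apply: tliftE => g2 g3; rewrite dact_pure.
rewrite {}RE {1}/sweedler3 comul_mul; last by split; lin.
rewrite tlift_exchange; apply: tliftE => g1 g23.
rewrite tlift_exchange [RHS]tlift_exchange.
rewrite tlift_exchange [RHS]tlift_exchange.
rewrite [RHS]tlift_exchange; apply: tliftE => f1 f23.
rewrite comul_mul; last by split; lin.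
rewrite tlift_exchange; apply: tliftE => g2 g3; apply: tliftE => f2 f3.
by rewrite antipM lactM ractM lact_ract mulrA.
Qed.

Lemma dact1 x : dact 1 x = x.
Proof.
apply: (tens_linear_ext (f := dact _) (g := id)) => //;
  first exact: dact_linear.
move=> a k; rewrite dact_pure /sweedler3 comul1 tlift_pure; last by split; lin.
rewrite comul1 tlift_pure; last by split; lin.
by rewrite antip1 lact_1 ract_1 mul1r.
Qed.

(** [ract f3] and [lact (S f1)] multiply 1 by counits, which contract the outer factors of the
    iterated coproduct. *)
Lemma dact_unit f : dact f (1 [x] 1) = 1 [x] f.
Proof.
rewrite dact_pure.
rewrite -[in RHS](tlift_counitl hU (g := id) f) //.
rewrite (tlift_linearl _ (f := pure 1)).
  apply: tliftE => f1 f23.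
  rewrite -[in RHS](tlift_counitr hU (g := id) f23) //.
  pose h (y : U) : tens A U := 1 [x] ((counit hU f1 : K) *: y).
  rewrite -[RHS]/(h _) (tlift_linearl _ (f := h)); last by rewrite /h; lin.
  apply: tliftE => f2 f3; rewrite /h ract1 (linear_scale (f := lact _));
    last lin.
  have pl : linear (pure^~ f2 : A -> tens A U) by lin.
  have pr : linear (pure 1 : U -> tens A U) by lin.
  rewrite lact1 counit_antip mulr1 scalerA !(linear_scale _ _ pl).
  by rewrite !(linear_scale _ _ pr) scalerA mulrC.
lin.
Qed.

Lemma double_mulE a f x : double_mul hA hU phi (a [x] f) x = lmul a (dact f x).
Proof.
rewrite /double_mul tlift_pure; last by rewrite /sweedler3; split; lin.
rewrite [dact f x]/dact (tlift_linearl _ (f := lmul a));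
  last exact: lmul_linear.
apply: tliftE => a' k.
rewrite (tlift_linearl _ (f := lmul a)); last exact: lmul_linear.
apply: tliftE => f1 f23.
rewrite (tlift_linearl _ (f := lmul a)); last exact: lmul_linear.
apply: tliftE => f2 f3; rewrite lact_ractE lmul_pure.
pose h y := (a * y) [x] (f2 * k) : tens A U.
rewrite -[RHS]/(h _) (tlift_linearl _ (f := h)); last by rewrite /h; lin.
apply: tliftE => a1 a23; rewrite (tlift_linearl _ (f := h));
  last by rewrite /h; lin.
apply: tliftE => a2 a3; rewrite (linear_scale (f := h)) //; rewrite /h; lin.
Qed.

Lemma ract_grouplike_mul g a b : comul hU g = g [x] g ->
  ract g (a * b) = ract g a * ract g b.
Proof. by move=> gD; rewrite ract_mul gD tlift_pure //; split; lin. Qed.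

Lemma lact_grouplike_mul g a b : comul hU g = g [x] g ->
  lact g (a * b) = lact g a * lact g b.
Proof. by move=> gD; rewrite lact_mul gD tlift_pure //; split; lin. Qed.

Lemma ract_skew_mul f g a b : comul hU f = 1 [x] f + f [x] g ->
  ract f (a * b) = ract f a * b + ract g a * ract f b.
Proof.
move=> fD; have bP : bilinear_map (fun f1 f2 => ract f2 a * ract f1 b).
  by split; lin.
rewrite ract_mul fD (linear_add (f := tlift _)); last exact: tlift_linear.
by rewrite !tlift_pure // ract_1.
Qed.

(** This shape of coproduct is that of h = S f_i, with g the inverse of w'_i; see
    [comul_antip_skew]. *)
Lemma lact_skew_mul h g a b : comul hU h = g [x] h + h [x] 1 ->
  lact h (a * b) = lact h a * lact g b + a * lact h b.
Proof.
move=> hD; have bP : bilinear_map (fun f1 f2 => lact f2 a * lact f1 b).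
  by split; lin.
rewrite lact_mul hD (linear_add (f := tlift _)); last exact: tlift_linear.
by rewrite !tlift_pure // lact_1.
Qed.

Lemma ract_grouplike f w : comul hA w = w [x] w -> ract f w = phi f w *: w.
Proof. by move=> wD; rewrite /ract wD tlift_pure //; split; lin. Qed.

Lemma lact_grouplike f w : comul hA w = w [x] w -> lact f w = phi f w *: w.
Proof. by move=> wD; rewrite /lact wD tlift_pure //; split; lin. Qed.

Lemma ract_skew f e w : comul hA e = e [x] 1 + w [x] e ->
  ract f e = phi f 1 *: e + phi f e *: w.
Proof.
move=> eD; have bP : bilinear_map (fun a1 a2 => phi f a2 *: a1) by split; lin.
rewrite /ract eD (linear_add (f := tlift _)); last exact: tlift_linear.
by rewrite !tlift_pure.
Qed.

Lemma lact_skew f e w : comul hA e = e [x] 1 + w [x] e ->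
  lact f e = phi f e *: 1 + phi f w *: e.
Proof.
move=> eD; have bP : bilinear_map (fun a1 a2 => phi f a1 *: a2) by split; lin.
rewrite /lact eD (linear_add (f := tlift _)); last exact: tlift_linear.
by rewrite !tlift_pure.
Qed.

(** * Action of a skew-primitive element f and of its group-like g *)

Section SkewPrimitive.
Variables (f g : U).
Hypotheses (gD : comul hU g = g [x] g) (fD : comul hU f = 1 [x] f + f [x] g).
Local Notation gV := (antip hU g).
Local Notation h := (antip hU f).
Hypotheses (gVD : comul hU gV = gV [x] gV) (hE : h = - (f * gV)).
Hypothesis (gVg : g * gV = 1).

(** Computed from the explicit formula S f = - f g^-1 and the multiplicativity of Delta, rather than
    from a general rule for Delta of an antipode. *)
Lemma comul_antip_skew : comul hU h = gV [x] h + h [x] 1.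
Proof.
have bP x : bilinear_map (fun y1 y2 : U => x * y1 [x] (f * y2)) by split; lin.
have cP : bilinear_map (fun x1 x2 : U =>
    tlift (fun y1 y2 => (x1 * y1) [x] (x2 * y2)) (gV [x] gV)) by split; lin.
rewrite hE linearN comulM gVD fD /tmul.
rewrite (linear_add (f := tlift _)); last exact: tlift_linear.
rewrite !tlift_pure //; try by split; lin.
rewrite gVg mul1r opprD; congr (_ + _).
  by rewrite (linear_opp (f := pure _)) //; lin.
by rewrite (linear_opp (f := pure^~ _)) //; lin.
Qed.

Lemma dact_grouplike a k : dact g (a [x] k) = lact gV (ract g a) [x] (g * k).
Proof.
rewrite dact_pure /sweedler3 gD tlift_pure; last by split; lin.
by rewrite gD tlift_pure //; split; lin.
Qed.

(** The terms come from the iterated coproduct of f, namely 1 (x) 1 (x) f + 1 (x) f (x) g + f (x) g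
    (x) g. *)
Lemma dact_skew a k : dact f (a [x] k) =
  ract f a [x] k + ract g a [x] (f * k) + lact h (ract g a) [x] (g * k).
Proof.
rewrite dact_pure /sweedler3 fD.
rewrite (linear_add (f := tlift _)); last by apply: tlift_linear; split; lin.
rewrite !tlift_pure; try by split; lin.
rewrite fD gD (linear_add (f := tlift _)); last first.
  by apply: tlift_linear; split; lin.
by rewrite !tlift_pure ?antip1 ?lact_1 ?mul1r //; split; lin.
Qed.

Lemma dact_lmul_grouplike a x :
  dact g (lmul a x) = lmul (lact gV (ract g a)) (dact g x).
Proof.
pose G x := lmul (lact gV (ract g a)) (dact g x).
apply: (tens_linear_ext (f := fun x => dact g (lmul a x)) (g := G)).
- by apply: linear_comp; [exact: dact_linear | exact: lmul_linear].
- by apply: linear_comp; [exact: lmul_linear | exact: dact_linear].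
move=> a' k; rewrite /G lmul_pure !dact_grouplike lmul_pure.
by rewrite ract_grouplike_mul // lact_grouplike_mul.
Qed.

(** On a' (x) k, the Leibniz rules for [ract f] and for [lact h] each split one term of [dact_skew]
    in two. The resulting five terms are the one of [lmul (ract f a)], the three of [dact f (a' [x]
    k)] multiplied by [ract g a], and the one of [dact g (a' [x] k)]. *)
Lemma dact_lmul_skew a x : dact f (lmul a x) =
  lmul (ract f a) x + lmul (ract g a) (dact f x) +
  lmul (lact h (ract g a)) (dact g x).
Proof.
pose G x := lmul (ract f a) x + lmul (ract g a) (dact f x) +
  lmul (lact h (ract g a)) (dact g x).
apply: (tens_linear_ext (f := fun x => dact f (lmul a x)) (g := G)).
- by apply: linear_comp; [exact: dact_linear | exact: lmul_linear].
- apply: linear_addf; last first.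
    by apply: linear_comp; [exact: lmul_linear | exact: dact_linear].
  apply: linear_addf; first exact: lmul_linear.
  by apply: linear_comp; [exact: lmul_linear | exact: dact_linear].
move=> a' k; rewrite /G lmul_pure !dact_skew dact_grouplike.
rewrite !(linear_add (lmul_linear _)) !lmul_pure.
rewrite (ract_skew_mul _ _ fD) ract_grouplike_mul //.
rewrite (lact_skew_mul _ _ comul_antip_skew).
have pl k' : linear (fun x : A => x [x] k') by lin.
by rewrite !(linear_add (pl _)) !addrA (ACl (1*2*3*5*4))%AC.
Qed.

End SkewPrimitive.

End DoubleAction.

(** * The product map of the double *)

Section HopfIsomorphism.
Variables (K : fieldType).

Lemma hopf_isomorphic_sym (H H' : hopf_data K) (f : H -> H') :
  hopf_morphism f -> bijective f -> hopf_isomorphic H' H.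
Proof.
move=> [fL [f1 [fM [fD [fe fS]]]]] [g gf fg]; exists g; last by exists f.
have gL : linear g by move=> a x y;
  rewrite -[in LHS](fg x) -[in LHS](fg y) -fL gf.
split=> //; split; first by rewrite -f1 gf.
split; first by move=> x y; rewrite -[in LHS](fg x) -[in LHS](fg y) -fM gf.
split; last first.
  by split=> x; [rewrite -fe fg | rewrite -[in LHS](fg x) -fS gf].
move=> x; rewrite -[in RHS](fg x) fD /tmap tlift_tlift; last first.
  by split=> ?; [apply: linear_purer | apply: linear_purel].
rewrite [LHS]pure_sumE; apply: eq_bigr => p _.
by rewrite tlift_pure ?gf //; split=> ?;
  [apply: linear_purer | apply: linear_purel].
Qed.

Variables (H A U : algType K).
Variables (hH : hopf_struct H) (hA : hopf_struct A) (hU : hopf_struct U).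
Variables (phi : U -> A -> K) (iA : A -> H) (iU : U -> H).
Hypothesis phiP : skew_dual_pairing hA hU phi.
Hypothesis iAP : @hopf_morphism K (hopf_of hA) (hopf_of hH) iA.
Hypothesis iUP : @hopf_morphism K (hopf_of hU) (hopf_of hH) iU.

Definition double_prod : tens A U -> H := tlift (fun a f => iA a * iU f).

Let iAL : linear iA. Proof. by case: iAP. Qed.
Let iUL : linear iU. Proof. by case: iUP. Qed.

Lemma double_prod_bilinear : bilinear_map (fun a f => iA a * iU f).
Proof. by split=> ?; [apply: linear_mulr | apply: linear_mull]. Qed.

Lemma double_prod_linear : linear double_prod.
Proof. exact/tlift_linear/double_prod_bilinear. Qed.

Lemma double_prod_pure a f : double_prod (a [x] f) = iA a * iU f.
Proof. exact/tlift_pure/double_prod_bilinear. Qed.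

Lemma double_prod_lmul a x : double_prod (lmul a x) = iA a * double_prod x.
Proof.
have iAM x1 x2 : iA (x1 * x2) = iA x1 * iA x2 by case: iAP => _ [_ [iAM _]];
  apply: iAM.
apply: (tens_linear_ext (f := fun x => double_prod (lmul a x))
                        (g := fun x => iA a * double_prod x)).
- by apply: linear_comp; [exact: double_prod_linear | exact: lmul_linear].
- by apply: linear_mulr; apply: double_prod_linear.
by move=> a' k; rewrite lmul_pure !double_prod_pure iAM mulrA.
Qed.

Ltac lin_extra ::= first
  [ apply: (linear_phil phiP) | apply: (linear_phir phiP) | apply: iAL
  | apply: iUL | apply: (linear_comp iAL) | apply: (linear_comp iUL) ].

(** The intertwining hypothesis is the cross relation of the double, read in H; with [double_mulE]
    it makes the product map multiplicative. Compatibility with Delta and the counit follows because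
    they are multiplicative on H, and with the antipode because S (a f) = S f S a, the order used in
    [double_antip]. *)
Lemma double_isomorphic :
  (forall f x, double_prod (dact hA hU phi f x) = iU f * double_prod x) ->
  bijective double_prod ->
  hopf_isomorphic (hopf_of hH) (drinfeld_double hA hU phi).
Proof.
move=> dactE.
have [_ [iA1 [iAM [iAD [iAe iAS]]]]] := iAP.
have [_ [iU1 [iUM [iUD [iUe iUS]]]]] := iUP.
have mulE x y : double_prod (double_mul hA hU phi x y) =
    double_prod x * double_prod y.
  pose F x := double_prod (double_mul hA hU phi x y).
  apply: (tens_linear_ext (f := F)
    (g := fun x => double_prod x * double_prod y)).
  - apply: (linear_comp double_prod_linear); apply: tlift_linear.
    by rewrite /sweedler3; split; lin.
  - by apply: linear_mull; apply: double_prod_linear.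
  move=> a f; rewrite /F double_mulE // double_prod_lmul dactE double_prod_pure.
  by rewrite mulrA.
move=> bij; apply: (@hopf_isomorphic_sym (drinfeld_double hA hU phi)
  (hopf_of hH) double_prod) => //.
split; first exact: double_prod_linear.
split; first by rewrite double_prod_pure [iA 1]iA1 [iU 1]iU1 /= mulr1.
split=> //; split; last split.
- pose F := tmap double_prod double_prod.
  have FP : bilinear_map (fun x y => double_prod x [x] double_prod y).
    split=> ?; [apply: linear_purer | apply: linear_purel];
      exact: double_prod_linear.
  have FL : linear F by apply: tlift_linear.
  apply: (tens_linear_ext (f := fun x => comul hH (double_prod x))
                          (g := fun x => F (double_comul hA hU x))).
  - by apply: linear_bundled; apply: double_prod_linear.
  - by apply: (linear_comp FL); apply: tlift_linear; split; lin.
  move=> a f; rewrite double_prod_pure comulM.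
  rewrite /double_comul tlift_pure; last by split; lin.
  have -> : comul hH (iA a) = tmap iA iA (comul hA a) := iAD a.
  have -> : comul hH (iU f) = tmap iU iU (comul hU f) := iUD f.
  rewrite (tlift_linearl _ (f := F)) // /tmul /tmap tlift_tlift; last first.
    by split; lin.
  apply: tliftE => a1 a2; rewrite tlift_pure; last by split; lin.
  rewrite (tlift_linearl _ (f := F)) // tlift_tlift; last by split; lin.
  apply: tliftE => f1 f2; rewrite tlift_pure; last by split; lin.
  by rewrite /F /tmap tlift_pure // !double_prod_pure.
- apply: (tens_linear_ext (f := fun x => counit hH (double_prod x) : K^o)
                          (g := double_counit hA hU)).
  - by apply: linear_bundled; apply: double_prod_linear.
  - by apply: tlift_linear; split; lin.
  move=> a f; rewrite double_prod_pure counitM.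
  have -> : counit hH (iA a) = counit hA a := iAe a.
  have -> : counit hH (iU f) = counit hU f := iUe f.
  by rewrite /double_counit tlift_pure //; split; lin.
- apply: (tens_linear_ext (f := fun x => double_prod (double_antip hA hU phi x))
                          (g := fun x => antip hH (double_prod x))).
  - apply: (linear_comp double_prod_linear); apply: tlift_linear.
    by rewrite /double_mul /sweedler3; split; lin.
  - by apply: linear_bundled; apply: double_prod_linear.
  move=> a f; rewrite double_prod_pure antipM /double_antip tlift_pure.
    rewrite mulE !double_prod_pure.
    have -> : antip hH (iA a) = iA (antip hA a) by rewrite -[LHS]iAS.
    have -> : antip hH (iU f) = iU (antip hU f) by rewrite -[LHS]iUS.
    by rewrite [iA 1]iA1 [iU 1]iU1 /= mulr1 mul1r.
  by rewrite /double_mul /sweedler3; split; lin.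
Qed.

End HopfIsomorphism.

(** * Actions of free and presented algebras *)

Section FreeAction.
Variables (K : fieldType) (X : choiceType) (V : lmodType K).
Variable T : X -> V -> V.
Hypothesis TL : forall x, linear (T x).
Local Notation F := (free_alg K X).

Definition word_act (m : {fmonom X}) (v : V) : V := foldr T v (m : seq X).

Definition free_act (a : F) (v : V) : V :=
  \sum_(k <- msupp (free_val a)) (free_val a)@_k *: word_act k v.

Lemma word_act_linear m : linear (word_act m).
Proof.
rewrite /word_act; elim: (m : seq X) => [//|x w IH] /= c u v.
by rewrite IH TL.
Qed.

Lemma free_act_linearr a : linear (free_act a).
Proof.
move=> c u v; rewrite /free_act scaler_sumr -big_split; apply: eq_bigr => k _.
by rewrite word_act_linear scalerDr !scalerA mulrC.
Qed.

Lemma free_actEw (d : {fset {fmonom X}}) a v :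
  (msupp (free_val a) `<=` d)%fset ->
  free_act a v = \sum_(k <- d) (free_val a)@_k *: word_act k v.
Proof.
move=> le; rewrite [LHS](big_fset_incl _ le) //= => x xd /mcoeff_outdom ->.
by rewrite scale0r.
Qed.

Lemma free_act_linearl v : linear (free_act^~ v).
Proof.
move=> c a b /=; pose ab := free_val (c *: a + b).
pose E := (msupp ab `|` (msupp (free_val a) `|` msupp (free_val b)))%fset.
rewrite !(free_actEw (d := E)) /E ?fsubsetUl //.
- rewrite scaler_sumr -big_split; apply: eq_bigr => k _.
  rewrite -[free_val _]/(c *: free_val a + free_val b).
  by rewrite mcoeffD mcoeffZ scalerDl scalerA.
- by rewrite fsubsetU // fsubsetUr orbT.
- by rewrite fsubsetU // fsubsetUl orbT.
Qed.

Lemma free_actU c m v : free_act (FreeAlg << c *g m >>) v = c *: word_act m v.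
Proof.
rewrite (free_actEw (d := [fset m]%fset)) ?msuppU_le //.
by rewrite big_seq_fset1 mcoeffUU.
Qed.

Lemma free_act_gen x v : free_act (fgen x) v = T x v.
Proof. by rewrite fgen.unlock free_actU scale1r /word_act fmU. Qed.

Lemma free_act1 v : free_act 1 v = v.
Proof.
by rewrite -[1 : F]/(FreeAlg << 1 *g mone >>) free_actU scale1r /word_act fm1.
Qed.

Lemma free_actM a b v : free_act (a * b) v = free_act a (free_act b v).
Proof.
have sumE (I : Type) (s : seq I) (g : I -> {malg K[{fmonom X}]}) :
    FreeAlg (\sum_(i <- s) g i) = \sum_(i <- s) FreeAlg (g i).
  by apply: (big_morph (@FreeAlg K X)).
have -> : a * b = FreeAlg (free_val a * free_val b).
  by apply: free_valP; rewrite free_valM.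
rewrite malgME sumE (linear_big_sum _ _ (free_act_linearl v)).
rewrite [RHS]/free_act; apply: eq_bigr => i _.
rewrite sumE (linear_big_sum _ _ (free_act_linearl v)).
rewrite [free_act b v]/free_act (linear_big_sum _ _ (word_act_linear i))
  scaler_sumr.
apply: eq_bigr => j _; rewrite free_actU.
rewrite (linear_scale _ _ (word_act_linear i)) scalerA.
by rewrite /word_act fmM foldr_cat.
Qed.

Lemma free_alg_ind (P : F -> Prop) :
  (forall x, P (fgen x)) -> (forall c, P c%:A) ->
  (forall a b, P a -> P b -> P (a + b)) ->
  (forall a b, P a -> P b -> P (a * b)) -> forall a, P a.
Proof.
move=> Pg Pc PD PM a.
have -> : a = \sum_(k <- msupp (free_val a)) FreeAlg << (free_val a)@_k *g k >>.
  rewrite -(big_morph (@FreeAlg K X) (id1 := 0) (op1 := +%R)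
    (id2 := 0) (op2 := +%R)) // -monalgE.
  by case: a.
have P0 : P 0 by rewrite -(scale0r 1).
apply: (big_ind P) => // m _; set c := mcoeff _ _.
have -> : FreeAlg << c *g m >> = c%:A * FreeAlg << m >>.
  rewrite mulr_algl; apply: free_valP => /=.
  rewrite -[RHS]/(c *: << m >>) -mul_malgC malgM_def fgmulUU mulr1.
  by rewrite mul1m.
apply: (PM) => //; case: m @c => w _; elim: w => [|x w IH].
  have -> : FMonom [::] = mone :> {fmonom X} by apply: val_inj; rewrite /= fm1.
  by rewrite -[FreeAlg _]/(1 : F) -(scale1r 1).
have -> : FreeAlg << FMonom (x :: w) >> = fgen x * FreeAlg << FMonom w >> :> F.
  apply: free_valP; rewrite free_valM fgen.unlock malgM_def fgmulUU mulr1.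
  by congr << _ >>; apply: val_inj; rewrite /= fmM fmU.
exact: PM.
Qed.

Lemma free_act_ideal (R : F -> F -> Prop) :
  (forall a b v, R a b -> free_act a v = free_act b v) ->
  forall a v, ideal R a -> free_act a v = 0.
Proof.
move=> RT a v Ia; elim: Ia v => [|{}a b _ IHa _ IHb|c d {}a b ab] v.
- by rewrite (linear_zero (free_act_linearl v)).
- by rewrite (linear_add (free_act_linearl v)) IHa IHb addr0.
- rewrite !free_actM (linear_add (free_act_linearl _)).
  rewrite (linear_opp _ (free_act_linearl _)) (RT _ _ _ ab) subrr.
  exact: linear_zero (free_act_linearr _).
Qed.

End FreeAction.

Section PresentedAlgebra.
Variables (K : fieldType) (X : choiceType).
Variable R : free_alg K X -> free_alg K X -> Prop.
Hypothesis nz : ~ ideal R 1.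
Local Notation Q := (presented nz).
Local Notation q := (ppi nz).

Lemma ppiM a b : q (a * b) = q a * q b. Proof. by rewrite [RHS]pmulE. Qed.

Lemma ppi_linear : linear q.
Proof. by move=> c a b; rewrite [c *: q a]pscaleE [RHS]paddE. Qed.

Lemma ppi1 : q 1 = 1. Proof. by []. Qed.

Lemma ppi_rel a b : R a b -> q a = q b.
Proof.
by move=> ab; apply/ppiP; rewrite -(mulr1 (a - b)) -(mul1r (a - b));
  apply: IdealRel.
Qed.

Variables (V : lmodType K) (T : X -> V -> V).
Hypothesis TL : forall x, linear (T x).
Hypothesis TR : forall a b v, R a b -> free_act T a v = free_act T b v.

Definition presented_act (u : Q) (v : V) : V := free_act T (repr u) v.

Lemma presented_act_pi a v : presented_act (q a) v = free_act T a v.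
Proof.
apply/eqP; rewrite -subr_eq0 -(linear_opp _ (free_act_linearl T v)).
rewrite -(linear_add (free_act_linearl T v)); apply/eqP.
by apply: (free_act_ideal TL TR); apply/(ppiP nz)/reprK.
Qed.

Lemma presented_act_linearl v : linear (presented_act^~ v).
Proof.
move=> c; elim/presented_ind=> a; elim/presented_ind=> b.
by rewrite -ppi_linear !presented_act_pi free_act_linearl.
Qed.

Lemma presented_actM u u' v :
  presented_act (u * u') v = presented_act u (presented_act u' v).
Proof.
elim/presented_ind: u => a; elim/presented_ind: u' => b.
by rewrite -ppiM !presented_act_pi free_actM.
Qed.

End PresentedAlgebra.

(** * Two-parameter quantum groups *)

Section HopfSubalgebra.
Variables (K : fieldType) (A : algType K) (X : Type) (g : X -> A).
Local Notation B := (subalg_gen g).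
Variables (hA : hopf_struct A) (hB : hopf_struct B).
Hypothesis hBA : hopf_subalgebra hA hB.

Lemma subalg_gen_ind (P : B -> Prop) :
  (forall x, P (sgen g x)) -> (forall c, P c%:A) ->
  (forall a b, P a -> P b -> P (a + b)) ->
  (forall a b, P a -> P b -> P (a * b)) -> forall a, P a.
Proof.
move=> Pg Pc PD PM [a a_g]; have /asboolP ga := a_g.
elim: ga a_g => [x|c|x y gx IHx gy IHy|x y gx IHx gy IHy] a_g.
- by rewrite (_ : SubalgGen _ = sgen g x) //; apply: val_inj.
- by rewrite (_ : SubalgGen _ = c%:A) //; apply: val_inj.
- have -> : SubalgGen a_g = SubalgGen (asboolT gx) + SubalgGen (asboolT gy).
    exact: val_inj.
  exact: PD.
- have -> : SubalgGen a_g = SubalgGen (asboolT gx) * SubalgGen (asboolT gy).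
    exact: val_inj.
  exact: PM.
Qed.

Lemma subalg_val_linear : linear (@subalg_val K A X g).
Proof. by case: hBA. Qed.

(** Allows the coproduct of B to be read off in U, since B (x) B embeds in U (x) U. *)
Lemma subalg_comul a y :
  comul hA (subalg_val a) =
    tmap (@subalg_val K A X g) (@subalg_val K A X g) y ->
  comul hB a = y.
Proof.
move=> aE; apply: (tmap_inj subalg_val_linear val_inj subalg_val_linear
  val_inj).
by rewrite -aE; have [_ [_ [_ [D _]]]] := hBA; symmetry; apply: D.
Qed.

Lemma subalg_counit a : counit hB a = counit hA (subalg_val a).
Proof. by have [_ [_ [_ [_ [e _]]]]] := hBA; symmetry; apply: e. Qed.

Lemma subalg_antip a : subalg_val (antip hB a) = antip hA (subalg_val a).
Proof. by have [_ [_ [_ [_ [_ S]]]]] := hBA; apply: S. Qed.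

Lemma tmap_subalg_pure a b :
  tmap (@subalg_val K A X g) (@subalg_val K A X g) (a [x] b) =
  subalg_val a [x] subalg_val b.
Proof.
have vL := subalg_val_linear.
by rewrite /tmap tlift_pure //; split=> ?;
  [apply: linear_purer | apply: linear_purel].
Qed.

Lemma tmap_subalg_linear : linear (tmap (@subalg_val K A X g) (@subalg_val K A
  X g)).
Proof.
have vL := subalg_val_linear.
by apply: tlift_linear; split=> ?; [apply: linear_purer | apply: linear_purel].
Qed.

End HopfSubalgebra.

(** Applied with c = p_ij, to g = w'_i and x = e_j, and to g = w_j and x = f_i. *)
Lemma conj_scale (K : fieldType) (A : algType K) (g gV x : A) (c : K) :
  g * gV = 1 -> gV * g = 1 -> c != 0 -> g * x * gV = c^-1 *: x ->
  [/\ g * x = c^-1 *: (x * g), gV * x = c *: (x * gV),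
      x * g = c *: (g * x) & x * gV = c^-1 *: (gV * x)].
Proof.
move=> ggV gVg c0 gx.
have gxE : g * x = c^-1 *: (x * g) by rewrite scalerAl -gx -!mulrA gVg mulr1.
have xgE : x * g = c *: (g * x) by rewrite gxE scalerA mulfV // scale1r.
have gVxE : gV * x = c *: (x * gV).
  by rewrite -[LHS]mulr1 -ggV mulrA -(mulrA gV) xgE -scalerAr mulrA gVg mul1r
    scalerAl.
by split=> //; rewrite gVxE scalerA mulVf // scale1r.
Qed.

Lemma commutator_swap (K : fieldType) (A : algType K) (x y a b : A) (c : K) :
  x * y - y * x = c *: (a - b) -> y * x = c *: b + x * y - c *: a.
Proof.
move=> e; rewrite addrAC -scalerBr -opprB scalerN -e opprB.
by rewrite -addrA addNr addr0.
Qed.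

Section SkewRules.
Variables (A : nzRingType) (f g a b r1 R1 L1 r2 R2 L2 C : A).
Hypotheses (fa : f * a = r1 + R1 * f + L1 * g) (fb : f * b =
  r2 + R2 * f + L2 * g).

(** Induction steps of [BF_straighten], with f = f_i and g = w'_i: r, R, L stand for the images of
    an element under [ract f], [ract g] and [lact (S f)] after [ract g]. In [skew_mul], C is the
    conjugate of b by w'_i. *)
Lemma skew_add :
  f * (a + b) = (r1 + r2) + (R1 + R2) * f + (L1 + L2) * g.
Proof. by rewrite mulrDr fa fb !mulrDl addrACA [X in X + _ = _]addrACA. Qed.

Lemma skew_mul : g * b = C * g ->
  f * (a * b) = (r1 * b + R1 * r2) + (R1 * R2) * f + (L1 * C + R1 * L2) * g.
Proof.
move=> gb; rewrite mulrA fa !mulrDl -!mulrA fb gb !mulrDr !addrA.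
by rewrite [LHS]addrAC.
Qed.

End SkewRules.

(** * Hopf operations on the generators of B and B' *)

Section UrsDouble.
Variables (K : fieldType) (r s : K) (t : lie_type) (n : nat).
Local Notation Q := (Urs r s t n).
Local Notation B := (Bplus r s t n).
Local Notation B' := (Bminus r s t n).
Local Notation I := (node t n).
Variables (hU : hopf_struct Q) (hB : hopf_struct B) (hB' : hopf_struct B').
Hypotheses (hUgen : Urs_hopf_values hU) (hBU : hopf_subalgebra hU hB)
  (hB'U : hopf_subalgebra hU hB').
Variable phi : B' -> B -> K.
Hypotheses (hphi : skew_dual_pairing hB hB' phi) (hphigen : pairing_values phi).

Local Notation bgen := (sgen (@Bgen_val K r s t n)).
Local Notation b'gen := (sgen (@B'gen_val K r s t n)).
Local Notation p := (p_ r s t n).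
Local Notation u x := (@ugen K r s t n x).

Lemma ugen_rel x y : @Urel K r s t n x y ->
  ppi (@Urel_proper K r s t n) x = ppi (@Urel_proper K r s t n) y.
Proof. exact: ppi_rel. Qed.

Lemma ugen_torusC x y : torus_gen x -> torus_gen y -> u x * u y = u y * u x.
Proof. by move=> xT yT; rewrite /ugen -!ppiM; apply/ugen_rel/RelTorus. Qed.

Lemma ugen_WV i : u (GW i) * u (GWinv i) = 1.
Proof. by rewrite /ugen -ppiM; apply/ugen_rel/RelInv. Qed.

Lemma ugen_W'V i : u (GW' i) * u (GW'inv i) = 1.
Proof. by rewrite /ugen -ppiM; apply/ugen_rel/RelInv'. Qed.

Definition grouplike_B (x : Bgen t n) := if x is BE _ then false else true.
Definition grouplike_B' (x : B'gen t n) := if x is BF _ then false else true.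

Lemma comul_bgen x : grouplike_B x -> comul hB (bgen x) = bgen x [x] bgen x.
Proof.
move=> xg; apply: (subalg_comul hBU); rewrite (tmap_subalg_pure hBU).
have [tP _] := hUgen.
by case: x xg => // i _;
  [have [] := tP (GW i) isT | have [] := tP (GWinv i) isT].
Qed.

Lemma counit_bgen x : grouplike_B x -> counit hB (bgen x) = 1.
Proof.
move=> xg; rewrite (subalg_counit hBU); have [tP _] := hUgen.
by case: x xg => // i _;
  [have [] := tP (GW i) isT | have [] := tP (GWinv i) isT].
Qed.

Lemma comul_b'gen x : grouplike_B' x ->
  comul hB' (b'gen x) = b'gen x [x] b'gen x.
Proof.
move=> xg; apply: (subalg_comul hB'U); rewrite (tmap_subalg_pure hB'U).
have [tP _] := hUgen.
by case: x xg => // i _;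
  [have [] := tP (GW' i) isT | have [] := tP (GW'inv i) isT].
Qed.

Lemma counit_b'gen x : grouplike_B' x -> counit hB' (b'gen x) = 1.
Proof.
move=> xg; rewrite (subalg_counit hB'U); have [tP _] := hUgen.
by case: x xg => // i _;
  [have [] := tP (GW' i) isT | have [] := tP (GW'inv i) isT].
Qed.

Lemma comul_BE i :
  comul hB (bgen (BE i)) = bgen (BE i) [x] 1 + bgen (BW i) [x] bgen (BE i).
Proof.
apply: (subalg_comul hBU); rewrite (linear_add (tmap_subalg_linear hBU)).
by rewrite !(tmap_subalg_pure hBU); have [_ [/(_ i) [-> _ _] _]] := hUgen.
Qed.

Lemma comul_BF i :
  comul hB' (b'gen (BF i)) =
    1 [x] b'gen (BF i) + b'gen (BF i) [x] b'gen (BW' i).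
Proof.
apply: (subalg_comul hB'U); rewrite (linear_add (tmap_subalg_linear hB'U)).
by rewrite !(tmap_subalg_pure hB'U); have [_ [_ /(_ i) [-> _ _]]] := hUgen.
Qed.

Lemma counit_BF i : counit hB' (b'gen (BF i)) = 0.
Proof.
by rewrite (subalg_counit hB'U); have [_ [_ /(_ i) [_ -> _]]] := hUgen.
Qed.

Lemma b'gen_W'V i : b'gen (BW' i) * b'gen (BW'inv i) = 1.
Proof. by apply: val_inj; apply: ugen_W'V. Qed.

Lemma b'gen_VW' i : b'gen (BW'inv i) * b'gen (BW' i) = 1.
Proof.
by apply: val_inj; rewrite /= -[RHS](ugen_W'V i); apply: ugen_torusC.
Qed.

(** [Urs_hopf_values] prescribes the antipode on e_i and f_i only; on a group-like it is forced by S
    f * f = 1. *)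
Lemma antip_grouplike (f g : B') : comul hB' f = f [x] f -> counit hB' f = 1 ->
  f * g = 1 -> antip hB' f = g.
Proof.
move=> fD fe fg; have := antipl hB' f; rewrite fD tlift_pure ?fe ?scale1r.
  by move=> /(congr1 (fun y => y * g)); rewrite -mulrA fg mulr1 mul1r.
by split; lin.
Qed.

Lemma antip_BW' i : antip hB' (b'gen (BW' i)) = b'gen (BW'inv i).
Proof.
by apply: antip_grouplike; rewrite ?comul_b'gen ?counit_b'gen ?b'gen_W'V.
Qed.

Lemma antip_BW'inv i : antip hB' (b'gen (BW'inv i)) = b'gen (BW' i).
Proof.
by apply: antip_grouplike; rewrite ?comul_b'gen ?counit_b'gen ?b'gen_VW'.
Qed.

Lemma antip_BF i :
  antip hB' (b'gen (BF i)) = - (b'gen (BF i) * b'gen (BW'inv i)).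
Proof.
apply: val_inj; rewrite [LHS](subalg_antip hB'U).
by have [_ [_ /(_ i) [_ _ ->]]] := hUgen.
Qed.

(** * The two actions of the generators of B' on those of B *)

Local Notation ract := (ract hB phi).
Local Notation lact := (lact hB phi).

Lemma ract_b'gen_BE y j : grouplike_B' y ->
  ract (b'gen y) (bgen (BE j)) = bgen (BE j).
Proof.
move=> yg; rewrite (ract_skew hphi _ (comul_BE j)) (phif1 hphi) counit_b'gen //.
by rewrite hphigen; case: y yg => // i _; rewrite scale0r addr0 scale1r.
Qed.

Lemma lact_b'gen_BE y j : grouplike_B' y ->
  lact (b'gen y) (bgen (BE j)) =
  pairing_gen r s y (BW j) *: bgen (BE j).
Proof.
move=> yg; rewrite (lact_skew hphi _ (comul_BE j)) !hphigen.
by case: y yg => // i _; rewrite scale0r add0r.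
Qed.

Lemma ract_b'gen y x : grouplike_B x ->
  ract (b'gen y) (bgen x) = pairing_gen r s y x *: bgen x.
Proof. by move=> xg; rewrite (ract_grouplike hphi) ?comul_bgen // hphigen. Qed.

Lemma lact_b'gen y x : grouplike_B x ->
  lact (b'gen y) (bgen x) = pairing_gen r s y x *: bgen x.
Proof. by move=> xg; rewrite (lact_grouplike hphi) ?comul_bgen // hphigen. Qed.

Definition inv_B' (y : B'gen t n) : B'gen t n :=
  match y with BF i => BF i | BW' i => BW'inv i | BW'inv i => BW' i end.

Definition inv_B (x : Bgen t n) : Bgen t n :=
  match x with BE i => BE i | BW i => BWinv i | BWinv i => BW i end.

Lemma antip_b'gen y : grouplike_B' y -> antip hB' (b'gen y) = b'gen (inv_B' y).
Proof. by case: y => // i _; rewrite ?antip_BW' ?antip_BW'inv. Qed.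

(* p_ij and p_ij^-1 are values of the pairing on inverse group-likes. *)
Lemma p_neq0 (i j : I) : p i j != 0.
Proof.
have: phi (b'gen (BW' i) * b'gen (BW'inv i)) (bgen (BW j)) = 1.
  by rewrite b'gen_W'V (phi1a hphi) counit_bgen.
rewrite (phiMa hphi) comul_bgen // tlift_pure; last first.
  by split=> ?; [apply: linear_Kmulr | apply: linear_Kmull];
    apply: (linear_phir hphi).
rewrite !hphigen /= => pV1; apply/eqP => p0.
by move/eqP: pV1; rewrite p0 mul0r eq_sym oner_eq0.
Qed.

(** For a group-like y this is conjugation by y in U, expressed through the pairing;
    [b'gen_straighten] identifies the two. *)
Definition conj_B' (y : B'gen t n) a :=
  lact (antip hB' (b'gen y)) (ract (b'gen y) a).

Lemma conj_BE y j : grouplike_B' y ->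
  conj_B' y (bgen (BE j)) = pairing_gen r s (inv_B' y) (BW j) *: bgen (BE j).
Proof.
move=> yg; rewrite /conj_B' ract_b'gen_BE // antip_b'gen // lact_b'gen_BE //.
by case: y yg.
Qed.

Lemma conj_bgen y x : grouplike_B' y -> grouplike_B x ->
  conj_B' y (bgen x) = bgen x.
Proof.
move=> yg xg; rewrite /conj_B' ract_b'gen // antip_b'gen //.
rewrite (linear_scale (f := lact _)); last by apply: (linear_lactr hphi).
rewrite lact_b'gen // scalerA.
by case: y yg => // i _; case: x xg => // j _ /=;
  rewrite ?mulfV ?mulVf ?scale1r ?p_neq0.
Qed.

(** The value <f_i, e_j>. It is opposite to the coefficient in [RelEF], as suits the reversed
    commutator f_i e_j - e_j f_i. *)
Definition EF_coef (i j : I) : K :=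
  if i == j then (s_ s t n i - r_ r t n i)^-1 else 0.

Lemma ract_BF_BE i j :
  ract (b'gen (BF i)) (bgen (BE j)) = EF_coef i j *: bgen (BW j).
Proof.
rewrite (ract_skew hphi _ (comul_BE j)) (phif1 hphi) counit_BF hphigen.
by rewrite scale0r add0r.
Qed.

Lemma lact_antip_BF i a : lact (antip hB' (b'gen (BF i))) a =
  - lact (b'gen (BW'inv i)) (lact (b'gen (BF i)) a).
Proof.
rewrite antip_BF (linear_opp (f := fun y => lact y a)) ?(lactM hphi) //.
exact: (linear_lactl hphi).
Qed.

Lemma lact_antip_BF_BE i j :
  lact (antip hB' (b'gen (BF i))) (bgen (BE j)) = (- EF_coef i j) *: 1.
Proof.
rewrite lact_antip_BF (lact_skew hphi (b'gen (BF i)) (comul_BE j)) !hphigen.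
rewrite scale0r addr0 (linear_scale (f := lact _));
  last exact: (linear_lactr hphi).
by rewrite (lact1 hphi) counit_b'gen // scale1r scaleNr.
Qed.

Lemma lact_antip_BF_bgen i x : grouplike_B x ->
  lact (antip hB' (b'gen (BF i))) (bgen x) = 0.
Proof.
move=> xg; rewrite lact_antip_BF lact_b'gen //.
have -> : pairing_gen r s (BF i) x = 0 by case: x xg.
by rewrite scale0r (linear_zero (f := lact _)) ?oppr0 //;
  apply: (linear_lactr hphi).
Qed.

(** * Mixed relations between the operators of B and B' *)

Local Notation lmul := (@lmul K B B').
Local Notation dact := (dact hB hB' phi).

Lemma lmulZ c a x : lmul (c *: a) x = c *: lmul a x.
Proof. exact: linear_scale (lmul_linearl x). Qed.

Lemma dact_lmul_b'gen y a x : grouplike_B' y ->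
  dact (b'gen y) (lmul a x) = lmul (conj_B' y a) (dact (b'gen y) x).
Proof.
move=> yg; apply: (dact_lmul_grouplike hphi); rewrite ?antip_b'gen //.
  exact: comul_b'gen.
by apply: comul_b'gen; case: y yg.
Qed.

Lemma dact_lmul_BF i a x : dact (b'gen (BF i)) (lmul a x) =
  lmul (ract (b'gen (BF i)) a) x +
  lmul (ract (b'gen (BW' i)) a) (dact (b'gen (BF i)) x) +
  lmul (lact (antip hB' (b'gen (BF i))) (ract (b'gen (BW' i)) a))
    (dact (b'gen (BW' i)) x).
Proof.
apply: (dact_lmul_skew hphi).
- exact: comul_b'gen.
- exact: comul_BF.
- by rewrite antip_BW'; apply: comul_b'gen.
- by rewrite antip_BW'; apply: antip_BF.
- by rewrite antip_BW'; apply: b'gen_W'V.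
Qed.

(** Pairing f_i with e_j in the third place of the iterated coproduct leaves w_j; pairing S f_i with
    e_j in the first place leaves -1 and the factor w'_i; the middle term lets f_i pass e_j. *)
Lemma dact_BF_BE i j x : dact (b'gen (BF i)) (lmul (bgen (BE j)) x) =
  EF_coef i j *: lmul (bgen (BW j)) x +
  lmul (bgen (BE j)) (dact (b'gen (BF i)) x) -
  EF_coef i j *: dact (b'gen (BW' i)) x.
Proof.
rewrite dact_lmul_BF ract_BF_BE ract_b'gen_BE // lact_antip_BF_BE !lmulZ.
by rewrite lmul1 scaleNr.
Qed.

Lemma dact_BF_bgen i x v : grouplike_B x ->
  dact (b'gen (BF i)) (lmul (bgen x) v) =
  pairing_gen r s (BW' i) x *: lmul (bgen x) (dact (b'gen (BF i)) v).
Proof.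
move=> xg; rewrite dact_lmul_BF !ract_b'gen //.
rewrite (linear_scale (f := lact _)); last exact: (linear_lactr hphi).
rewrite lact_antip_BF_bgen // !lmulZ.
rewrite (linear_zero (lmul_linearl _)) scaler0 addr0.
have -> : pairing_gen r s (BF i) x = 0 by case: x xg.
by rewrite scale0r add0r.
Qed.

Lemma dact_b'gen_BE y j x : grouplike_B' y ->
  dact (b'gen y) (lmul (bgen (BE j)) x) =
  pairing_gen r s (inv_B' y) (BW j) *: lmul (bgen (BE j)) (dact (b'gen y) x).
Proof. by move=> yg; rewrite dact_lmul_b'gen // conj_BE // lmulZ. Qed.

Lemma dact_b'gen_bgen y x v : grouplike_B' y -> grouplike_B x ->
  dact (b'gen y) (lmul (bgen x) v) = lmul (bgen x) (dact (b'gen y) v).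
Proof. by move=> yg xg; rewrite dact_lmul_b'gen // conj_bgen. Qed.

(** * The action of U on B (x) B' *)

Local Notation D := (tens B B').
Local Notation F := (free_alg K (Ugen t n)).
Local Notation q := (ppi (@Urel_proper K r s t n)).

Definition ugen_act (x : Ugen t n) : D -> D :=
  match x with
  | GE i => lmul (bgen (BE i))
  | GW i => lmul (bgen (BW i))
  | GWinv i => lmul (bgen (BWinv i))
  | GF i => dact (b'gen (BF i))
  | GW' i => dact (b'gen (BW' i))
  | GW'inv i => dact (b'gen (BW'inv i))
  end.

Lemma ugen_act_linear x : linear (ugen_act x).
Proof.
case: x => i /=.
all: by [apply: (lmul_linear (U := B')) | apply: (dact_linear hphi)].
Qed.

Local Notation act := (free_act ugen_act).
Local Notation act_addl := (linear_add (free_act_linearl ugen_act _)).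
Local Notation act_oppl := (linear_opp _ (free_act_linearl ugen_act _)).
Local Notation act_scalel := (linear_scale _ _ (free_act_linearl ugen_act _)).

(* Elements of the free algebra whose action factors through B, resp. B'.  *)
(* On these, the relations of U hold because they hold in B, resp. B'.     *)
Definition acts_in_B (z : F) : Prop :=
  exists2 b : B, subalg_val b = q z & forall x, act z x = lmul b x.

Definition acts_in_B' (z : F) : Prop :=
  exists2 f : B', subalg_val f = q z & forall x, act z x = dact f x.

Lemma acts_in_B_eq z z' x : acts_in_B z -> acts_in_B z' -> q z = q z' ->
  act z x = act z' x.
Proof.
move=> [b bz zE] [b' bz' zE'] zz'; rewrite zE zE'; congr (lmul _ x).
by apply: val_inj; rewrite /= bz bz'.
Qed.

Lemma acts_in_B'_eq z z' x : acts_in_B' z -> acts_in_B' z' -> q z = q z' ->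
  act z x = act z' x.
Proof.
move=> [b bz zE] [b' bz' zE'] zz'; rewrite zE zE'; congr (dact _ x).
by apply: val_inj; rewrite /= bz bz'.
Qed.

Lemma acts_in_B_M z z' : acts_in_B z -> acts_in_B z' -> acts_in_B (z * z').
Proof.
move=> [b bz zE] [b' bz' zE']; exists (b * b') => [|x].
  by rewrite /= bz bz' ppiM.
by rewrite (free_actM ugen_act_linear) zE zE' lmulM.
Qed.

Lemma acts_in_B'_M z z' : acts_in_B' z -> acts_in_B' z' -> acts_in_B' (z * z').
Proof.
move=> [b bz zE] [b' bz' zE']; exists (b * b') => [|x].
  by rewrite /= bz bz' ppiM.
by rewrite (free_actM ugen_act_linear) zE zE' (dactM hphi).
Qed.

Lemma acts_in_B_lin c z z' : acts_in_B z -> acts_in_B z' ->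
  acts_in_B (c *: z + z').
Proof.
move=> [b bz zE] [b' bz' zE']; exists (c *: b + b') => [|x].
  by rewrite (subalg_val_linear hBU) bz bz' ppi_linear.
by rewrite free_act_linearl zE zE' lmul_linearl.
Qed.

Lemma acts_in_B'_lin c z z' :
  acts_in_B' z -> acts_in_B' z' -> acts_in_B' (c *: z + z').
Proof.
move=> [b bz zE] [b' bz' zE']; exists (c *: b + b') => [|x].
  by rewrite (subalg_val_linear hB'U) bz bz' ppi_linear.
by rewrite free_act_linearl zE zE' (dact_linearl hphi).
Qed.

Lemma acts_in_B_1 : acts_in_B 1.
Proof. by exists 1 => // x; rewrite free_act1 lmul1. Qed.

Lemma acts_in_B'_1 : acts_in_B' 1.
Proof. by exists 1 => // x; rewrite free_act1 (dact1 hphi). Qed.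

Lemma acts_in_B_0 : acts_in_B 0.
Proof.
exists 0 => [|x]; first by rewrite (linear_zero (ppi_linear _)).
by rewrite (linear_zero (free_act_linearl _ _)) (linear_zero (lmul_linearl _)).
Qed.

Lemma acts_in_B'_0 : acts_in_B' 0.
Proof.
exists 0 => [|x]; first by rewrite (linear_zero (ppi_linear _)).
rewrite (linear_zero (free_act_linearl _ _)).
by rewrite (linear_zero (dact_linearl hphi _)).
Qed.

Lemma acts_in_B_scale c z : acts_in_B z -> acts_in_B (c *: z).
Proof.
by move=> zB; rewrite -[_ *: _]addr0; apply: acts_in_B_lin acts_in_B_0.
Qed.

Lemma acts_in_B'_scale c z : acts_in_B' z -> acts_in_B' (c *: z).
Proof.
by move=> zB; rewrite -[_ *: _]addr0; apply: acts_in_B'_lin acts_in_B'_0.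
Qed.

Definition Bgen_ugen (x : Bgen t n) : Ugen t n :=
  match x with BE i => GE i | BW i => GW i | BWinv i => GWinv i end.

Definition B'gen_ugen (y : B'gen t n) : Ugen t n :=
  match y with BF i => GF i | BW' i => GW' i | BW'inv i => GW'inv i end.

Lemma ugen_act_bgen x : ugen_act (Bgen_ugen x) = lmul (bgen x).
Proof. by case: x. Qed.

Lemma ugen_act_b'gen y : ugen_act (B'gen_ugen y) = dact (b'gen y).
Proof. by case: y. Qed.

Lemma acts_in_B_gen x : acts_in_B (fgen (Bgen_ugen x)).
Proof.
exists (bgen x) => [|v]; first by case: x.
by rewrite free_act_gen ugen_act_bgen.
Qed.

Lemma acts_in_B'_gen y : acts_in_B' (fgen (B'gen_ugen y)).
Proof.
exists (b'gen y) => [|v]; first by case: y.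
by rewrite free_act_gen ugen_act_b'gen.
Qed.

(** Splits a torus relation into the cases inside B, inside B' and mixed; only the mixed one needs
    the pairing. *)
Variant torus_spec : Ugen t n -> Prop :=
| TorusB x of grouplike_B x : torus_spec (Bgen_ugen x)
| TorusB' y of grouplike_B' y : torus_spec (B'gen_ugen y).

Lemma torusP x : torus_gen x -> torus_spec x.
Proof.
case: x => // i _.
- exact: (@TorusB (BW i)).
- exact: (@TorusB (BWinv i)).
- exact: (@TorusB' (BW' i)).
- exact: (@TorusB' (BW'inv i)).
Qed.

Lemma acts_in_B_word L : acts_in_B (word_eval (fun i => fgen (GE i)) L).
Proof.
rewrite /word_eval; elim: L => [|cw L IH].
  by rewrite big_nil; apply: acts_in_B_0.
rewrite big_cons; apply: acts_in_B_lin IH.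
apply: big_ind => [|z z'|i _]; first exact: acts_in_B_1.
  exact: acts_in_B_M.
exact: (acts_in_B_gen (BE i)).
Qed.

Lemma acts_in_B'_word L : acts_in_B' (word_eval (fun i => fgen (GF i)) L).
Proof.
rewrite /word_eval; elim: L => [|cw L IH].
  by rewrite big_nil; apply: acts_in_B'_0.
rewrite big_cons; apply: acts_in_B'_lin IH.
apply: big_ind => [|z z'|i _]; first exact: acts_in_B'_1.
  exact: acts_in_B'_M.
exact: (acts_in_B'_gen (BF i)).
Qed.

Definition actE :=
  (free_actM ugen_act_linear, free_act_gen, @free_act1 K (Ugen t n)).

Lemma lmulVK x v : grouplike_B x ->
  lmul (bgen x) (lmul (bgen (inv_B x)) v) = v.
Proof.
move=> xg; rewrite -lmulM -[RHS]lmul1; congr (lmul _ v); apply: val_inj.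
case: x xg => // i _ /=; first exact: ugen_WV.
by rewrite -[RHS](ugen_WV i); apply: ugen_torusC.
Qed.

Lemma dactVK y v : grouplike_B' y ->
  dact (b'gen y) (dact (b'gen (inv_B' y)) v) = v.
Proof.
move=> yg; rewrite -(dactM hphi) -[RHS](dact1 hphi).
by case: y yg => // i _; rewrite ?b'gen_W'V ?b'gen_VW'.
Qed.

Lemma ugen_act_rel a b v : @Urel K r s t n a b -> act a v = act b v.
Proof.
move=> ab; have qab := ugen_rel ab.
case: ab qab => [x y|i|i|i j|i j|i j|i j|i j|L _|L _].
- case/torusP=> x' x'g; case/torusP=> y' y'g qab.
  + by apply: (acts_in_B_eq _ _ _ qab); apply: acts_in_B_M;
      apply: acts_in_B_gen.
  + by rewrite !actE ugen_act_bgen ugen_act_b'gen dact_b'gen_bgen.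
  + by rewrite !actE ugen_act_bgen ugen_act_b'gen dact_b'gen_bgen.
  + by apply: (acts_in_B'_eq _ _ _ qab); apply: acts_in_B'_M;
      apply: acts_in_B'_gen.
- move=> qab; apply: (acts_in_B_eq _ _ _ qab); last exact: acts_in_B_1.
  by apply: acts_in_B_M;
    [apply: (acts_in_B_gen (BW i)) | apply: (acts_in_B_gen (BWinv i))].
- move=> qab; apply: (acts_in_B'_eq _ _ _ qab); last exact: acts_in_B'_1.
  by apply: acts_in_B'_M;
    [apply: (acts_in_B'_gen (BW' i)) | apply: (acts_in_B'_gen (BW'inv i))].
- move=> qab; apply: (acts_in_B_eq _ _ _ qab); last first.
    by apply: acts_in_B_scale; apply: (acts_in_B_gen (BE i)).
  apply: acts_in_B_M; last exact: (acts_in_B_gen (BWinv j)).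
  by apply: acts_in_B_M;
    [apply: (acts_in_B_gen (BW j)) | apply: (acts_in_B_gen (BE i))].
(* The scalar p_ij^-1 is <w'_i, w_j^-1>, picked up when f_i passes w_j^-1. *)
- move=> _; rewrite act_scalel !actE /= dact_BF_bgen //.
  rewrite (linear_scale _ _ (lmul_linear _)) /=.
  by rewrite -[BWinv j]/(inv_B (BW j)) lmulVK.
(* Here the scalar is <w'_j^-1, w_i> = p_ji^-1, from the antipode of w'_j acting on e_i. *)
- move=> _; rewrite act_scalel !actE /= dact_b'gen_BE //=.
  by congr (_ *: lmul _ _); apply: (dactVK (y := BW' j)).
- move=> qab; apply: (acts_in_B'_eq _ _ _ qab); last first.
    by apply: acts_in_B'_scale; apply: (acts_in_B'_gen (BF i)).
  apply: acts_in_B'_M; last exact: (acts_in_B'_gen (BW'inv j)).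
  by apply: acts_in_B'_M;
    [apply: (acts_in_B'_gen (BW' j)) | apply: (acts_in_B'_gen (BF i))].
(* The e_i f_j terms cancel; passing from 1/(s_i - r_i) to 1/(r_i - s_i) absorbs the remaining
   sign. *)
- move=> _; rewrite act_addl act_oppl !actE /= dact_BF_BE.
  rewrite 2!opprD opprK addrA [X in X + _]addrCA subrr addr0 /EF_coef eq_sym.
  case: eqP => [->|_]; last first.
    by rewrite !scale0r oppr0 addr0 (linear_zero (free_act_linearl _ _)).
  rewrite act_scalel act_addl act_oppl !actE /=.
  by rewrite -[in RHS]opprB invrN scaleNr scalerBr opprB addrC.
- by move=> qab; apply: (acts_in_B_eq _ _ _ qab);
    [apply: acts_in_B_word | apply: acts_in_B_0].
- by move=> qab; apply: (acts_in_B'_eq _ _ _ qab);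
    [apply: acts_in_B'_word | apply: acts_in_B'_0].
Qed.

(** * Straightening products of B' and B inside U *)

Local Notation valB := (@subalg_val K Q (Bgen t n) (@Bgen_val K r s t n)).
Local Notation valB' := (@subalg_val K Q (B'gen t n) (@B'gen_val K r s t n)).

Lemma valBM a b : valB (a * b) = valB a * valB b. Proof. by []. Qed.
Lemma valB1 : valB 1 = 1. Proof. by []. Qed.
Lemma valB'M a b : valB' (a * b) = valB' a * valB' b. Proof. by []. Qed.

Lemma valB_bgen x : valB (bgen x) = u (Bgen_ugen x). Proof. by case: x. Qed.
Lemma valB'_b'gen y : valB' (b'gen y) = u (B'gen_ugen y).
Proof. by case: y. Qed.

Lemma ugen_VW i : u (GWinv i) * u (GW i) = 1.
Proof. by rewrite -[RHS](ugen_WV i); apply: ugen_torusC. Qed.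

Lemma ugen_VW' i : u (GW'inv i) * u (GW' i) = 1.
Proof. by rewrite -[RHS](ugen_W'V i); apply: ugen_torusC. Qed.

Lemma ugen_W'E i j :
  u (GW' i) * u (GE j) * u (GW'inv i) = (p i j)^-1 *: u (GE j).
Proof.
by have := ugen_rel (RelW'E r s j i);
  rewrite !ppiM (linear_scale _ _ (ppi_linear _)).
Qed.

Lemma ugen_WF i j :
  u (GW j) * u (GF i) * u (GWinv j) = (p i j)^-1 *: u (GF i).
Proof.
by have := ugen_rel (RelWF r s i j);
  rewrite !ppiM (linear_scale _ _ (ppi_linear _)).
Qed.

Lemma ugen_EF i j : u (GE j) * u (GF i) - u (GF i) * u (GE j) =
  EF_coef i j *: (u (GW' i) - u (GW j)).
Proof.
have := ugen_rel (RelEF r s j i).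
rewrite (linear_add (ppi_linear _)) (linear_opp _ (ppi_linear _)) !ppiM => ->.
rewrite /EF_coef eq_sym; case: eqP => [->|_]; last first.
  by rewrite (linear_zero (ppi_linear _)) scale0r.
rewrite (linear_scale _ _ (ppi_linear _)) (linear_add (ppi_linear _)).
by rewrite (linear_opp _ (ppi_linear _)) -opprB invrN scaleNr -scalerN opprB.
Qed.

Lemma b'gen_BE_comm y j : grouplike_B' y ->
  valB' (b'gen y) * valB (bgen (BE j)) =
  pairing_gen r s (inv_B' y) (BW j) *: (valB (bgen (BE j)) * valB' (b'gen y)).
Proof.
rewrite valB_bgen valB'_b'gen; case: y => // i _ /=.
all: have [e eV _ _] :=
  conj_scale (ugen_W'V i) (ugen_VW' i) (p_neq0 i j) (ugen_W'E i j).
  exact: e.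
exact: eV.
Qed.

Lemma BF_bgen_comm i x : grouplike_B x ->
  valB' (b'gen (BF i)) * valB (bgen x) =
  pairing_gen r s (BW' i) x *: (valB (bgen x) * valB' (b'gen (BF i))).
Proof.
rewrite valB_bgen valB'_b'gen; case: x => // j _ /=.
all: have [_ _ e eV] :=
  conj_scale (ugen_WV j) (ugen_VW j) (p_neq0 i j) (ugen_WF i j).
  exact: e.
exact: eV.
Qed.

Lemma BF_BE_comm i j :
  valB' (b'gen (BF i)) * valB (bgen (BE j)) =
  EF_coef i j *: valB (bgen (BW j)) +
  valB (bgen (BE j)) * valB' (b'gen (BF i)) -
  EF_coef i j *: valB' (b'gen (BW' i)).
Proof.
rewrite !valB_bgen !valB'_b'gen; exact: commutator_swap (ugen_EF i j).
Qed.

Lemma conj_B'_linear y : linear (conj_B' y).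
Proof.
by rewrite /conj_B'; apply: (linear_lactr hphi); apply: (linear_ractr hphi).
Qed.

Lemma conj_B'_mul y a b : grouplike_B' y ->
  conj_B' y (a * b) = conj_B' y a * conj_B' y b.
Proof.
move=> yg; rewrite /conj_B' (ract_grouplike_mul hphi) ?comul_b'gen //.
by rewrite (lact_grouplike_mul hphi) // antip_b'gen // comul_b'gen //;
  case: y yg.
Qed.

(** Counterpart in U of [dact_grouplike]. Conjugation and [conj_B'] are both multiplicative, so
    generators suffice: e_j is scaled by a value of the pairing, and group-likes commute. *)
Lemma b'gen_straighten y a : grouplike_B' y ->
  valB' (b'gen y) * valB a = valB (conj_B' y a) * valB' (b'gen y).
Proof.
move=> yg; have cL := conj_B'_linear y; have vL := subalg_val_linear hBU.
have yVg : grouplike_B' (inv_B' y) by case: y yg {cL}.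
elim/subalg_gen_ind: a => [x|c|a b IHa IHb|a b IHa IHb].
- case xE: x => [j|j|j].
  + rewrite conj_BE // b'gen_BE_comm //.
    by rewrite (linear_scale _ _ vL) scalerAl.
  + rewrite conj_bgen // valB_bgen valB'_b'gen; apply: ugen_torusC => //.
    by case: y yg {cL yVg}.
  + rewrite conj_bgen // valB_bgen valB'_b'gen; apply: ugen_torusC => //.
    by case: y yg {cL yVg}.
- rewrite (linear_scale _ _ cL) !(linear_scale _ _ vL).
  rewrite /conj_B' (ract1 hphi) counit_b'gen // scale1r (lact1 hphi).
  by rewrite antip_b'gen // counit_b'gen //
    scale1r valB1 -scalerAl -scalerAr mulr1 mul1r.
- by rewrite (linear_add cL) !(linear_add vL) mulrDr mulrDl IHa IHb.
- by rewrite conj_B'_mul // !valBM mulrA IHa -mulrA IHb mulrA.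
Qed.

(** Counterpart in U of [dact_skew]. The relations of U give it on the generators of B; for
    products, [ract] and [lact] follow the Leibniz rules that [skew_mul] produces, where
    [b'gen_straighten] moves w'_i past the second factor. *)
Lemma BF_straighten i a :
  valB' (b'gen (BF i)) * valB a = valB (ract (b'gen (BF i)) a) +
  valB (ract (b'gen (BW' i)) a) * valB' (b'gen (BF i)) +
  valB (lact (antip hB' (b'gen (BF i))) (ract (b'gen (BW' i)) a)) *
    valB' (b'gen (BW' i)).
Proof.
have vL := subalg_val_linear hBU.
have rL f : linear (ract f) by apply: (linear_ractr hphi).
have lL f : linear (lact f) by apply: (linear_lactr hphi).
elim/subalg_gen_ind: a => [x|c|a b IHa IHb|a b IHa IHb].
- case: (boolP (grouplike_B x)) => xg.
    rewrite !ract_b'gen // (linear_scale _ _ (lL _)) lact_antip_BF_bgen //.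
    rewrite scaler0 (linear_zero vL) mul0r addr0 !(linear_scale _ _ vL).
    have -> : pairing_gen r s (BF i) x = 0 by case: x xg.
    by rewrite scale0r add0r -scalerAl; apply: BF_bgen_comm.
  case: x xg => // j _; rewrite BF_BE_comm ract_BF_BE ract_b'gen_BE //.
  by rewrite lact_antip_BF_BE !(linear_scale _ _ vL) valB1 -scalerAl mul1r
    scaleNr.
- rewrite !(linear_scale _ _ (rL _)) !(ract1 hphi) counit_BF scale0r scaler0.
  rewrite counit_b'gen // scale1r (linear_scale _ _ (lL _)) (lact1 hphi).
  rewrite counit_antip counit_BF scale0r scaler0 (linear_zero vL) mul0r addr0.
  by rewrite add0r !(linear_scale _ _ vL) valB1 -scalerAl -scalerAr mulr1 mul1r.
- rewrite !(linear_add (rL _)) (linear_add (lL _)) !(linear_add vL).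
  exact: skew_add.
- rewrite (ract_skew_mul hphi _ _ (comul_BF i)).
  rewrite (ract_grouplike_mul hphi) ?comul_b'gen //.
  rewrite (lact_skew_mul hphi _ _ (g := b'gen (BW'inv i))); last first.
    by rewrite -antip_BW'; apply: comul_antip_skew;
      rewrite ?antip_BW' ?b'gen_W'V;
      [apply: comul_BF | apply: comul_b'gen | apply: antip_BF |].
  rewrite 2!(linear_add vL) !valBM; apply: skew_mul IHa IHb _.
  by have := b'gen_straighten b (isT : grouplike_B' (BW' i));
    rewrite /conj_B' antip_BW'.
Qed.

(** * U-linearity and bijectivity of the product map *)

Local Notation m := (double_prod valB valB').

(** On a generator f and a pure tensor this is one of the two straightening rules; it passes to
    products because [dact] and left multiplication are both actions of B'. *)
Lemma double_prod_dact f x : m (dact f x) = valB' f * m x.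
Proof.
have vL := subalg_val_linear hB'U; have mL := double_prod_linear hBU hB'U.
elim/subalg_gen_ind: f x => [y|c|f g IHf IHg|f g IHf IHg] x.
- apply: (tens_linear_ext (f := fun x => m (dact (b'gen y) x))
                          (g := fun x => valB' (b'gen y) * m x)) => [||a k].
  + by apply: (linear_comp mL); apply: (dact_linear hphi).
  + by apply: linear_mulr.
  rewrite (double_prod_pure hBU hB'U) mulrA.
  case: (boolP (grouplike_B' y)) => yg.
    rewrite (dact_grouplike hphi) ?comul_b'gen // (double_prod_pure hBU hB'U).
    by rewrite valB'M mulrA b'gen_straighten.
  case: y yg => // i _.
  have gD := comul_b'gen (isT : grouplike_B' (BW' i)).
  rewrite (dact_skew hphi gD (comul_BF i)).
  rewrite !(linear_add mL) !(double_prod_pure hBU hB'U) BF_straighten !valB'M.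
  by rewrite !mulrDl !mulrA.
- rewrite (linear_scale _ _ (dact_linearl hphi x)) (dact1 hphi).
  by rewrite (linear_scale _ _ mL) (linear_scale _ _ vL) -[valB' 1]/1 mulr_algl.
- rewrite (linear_add (dact_linearl hphi x)) (linear_add mL) (linear_add vL).
  by rewrite mulrDl IHf IHg.
- by rewrite (dactM hphi) IHf IHg mulrA.
Qed.

Lemma double_prod_act z x : m (act z x) = q z * m x.
Proof.
have mL := double_prod_linear hBU hB'U.
have qL := ppi_linear (@Urel_proper K r s t n).
elim/free_alg_ind: z x => [y|c|a b IHa IHb|a b IHa IHb] x.
- rewrite free_act_gen; case: y => i /=.
  + exact: (double_prod_lmul hBU hB'U).
  + exact: double_prod_dact.
  + exact: (double_prod_lmul hBU hB'U).
  + exact: (double_prod_lmul hBU hB'U).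
  + exact: double_prod_dact.
  + exact: double_prod_dact.
- rewrite act_scalel free_act1 (linear_scale _ _ mL) (linear_scale _ _ qL).
  by rewrite ppi1 mulr_algl.
- by rewrite act_addl (linear_add mL) (linear_add qL) mulrDl IHa IHb.
- by rewrite (free_actM ugen_act_linear) IHa IHb ppiM mulrA.
Qed.

Local Notation uact := (@presented_act K (Ugen t n) (@Urel K r s t n)
  (@Urel_proper K r s t n) D ugen_act).

Lemma uactE z x : uact (q z) x = act z x.
Proof. exact: (presented_act_pi _ ugen_act_linear ugen_act_rel). Qed.

Lemma uact_valB b x : uact (valB b) x = lmul b x.
Proof.
have vL := subalg_val_linear hBU.
have uL y : linear (uact^~ y).
  exact: (presented_act_linearl ugen_act_linear ugen_act_rel).
elim/subalg_gen_ind: b x => [y|c|f g IHf IHg|f g IHf IHg] x.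
- by rewrite valB_bgen [LHS]uactE free_act_gen ugen_act_bgen.
- rewrite lmulZ lmul1 (linear_scale _ _ vL) (linear_scale _ _ (uL x)) valB1.
  by rewrite -(ppi1 (@Urel_proper K r s t n)) uactE free_act1.
- by rewrite (linear_add vL) (linear_add (uL x)) IHf IHg (linear_add
    (lmul_linearl x)).
- by rewrite valBM (presented_actM ugen_act_linear ugen_act_rel) IHf IHg lmulM.
Qed.

Lemma uact_valB' f x : uact (valB' f) x = dact f x.
Proof.
have vL := subalg_val_linear hB'U.
have uL y : linear (uact^~ y).
  exact: (presented_act_linearl ugen_act_linear ugen_act_rel).
elim/subalg_gen_ind: f x => [y|c|f g IHf IHg|f g IHf IHg] x.
- by rewrite valB'_b'gen [LHS]uactE free_act_gen ugen_act_b'gen.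
- rewrite (linear_scale _ _ (dact_linearl hphi x)) (dact1 hphi).
  rewrite (linear_scale _ _ vL) (linear_scale _ _ (uL x)) -[valB' 1]/1.
  by rewrite -(ppi1 (@Urel_proper K r s t n)) uactE free_act1.
- rewrite (linear_add vL) (linear_add (uL x)) IHf IHg.
  by rewrite (linear_add (dact_linearl hphi x)).
- by rewrite valB'M (presented_actM ugen_act_linear ugen_act_rel) IHf IHg
    (dactM hphi).
Qed.

Lemma double_prod_bij : bijective m.
Proof.
have uL y : linear (uact^~ y).
  exact: (presented_act_linearl ugen_act_linear ugen_act_rel).
exists (uact^~ (1 [x] 1)) => [x|].
  apply: (tens_linear_ext (f := fun x => uact (m x) (1 [x] 1)) (g := id)) => //.
    exact: (linear_comp (uL _) (double_prod_linear hBU hB'U)).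
  move=> a k; rewrite (double_prod_pure hBU hB'U).
  rewrite (presented_actM ugen_act_linear ugen_act_rel).
  by rewrite uact_valB uact_valB' (dact_unit hphi) lmul_pure mulr1.
elim/presented_ind=> z;
  rewrite uactE double_prod_act (double_prod_pure hBU hB'U).
by rewrite valB1 -[valB' 1]/1 !mulr1.
Qed.

Lemma Urs_double_isomorphic :
  hopf_isomorphic (hopf_of hU) (drinfeld_double hB hB' phi).
Proof.
exact: (double_isomorphic hphi hBU hB'U double_prod_dact double_prod_bij).
Qed.

End UrsDouble.

Theorem theorem2p5 (K : fieldType) (r s : K) (t : lie_type) (n : nat)
  (hrs : two_parameter_field r s) (hn : admissible t n)
  (hU : hopf_struct (Urs r s t n)) (hUgen : Urs_hopf_values hU)
  (hB : hopf_struct (Bplus r s t n)) (hBU : hopf_subalgebra hU hB)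
  (hB' : hopf_struct (Bminus r s t n)) (hB'U : hopf_subalgebra hU hB')
  (phi : Bminus r s t n -> Bplus r s t n -> K)
  (hphi : skew_dual_pairing hB hB' phi) (hphigen : pairing_values phi) :
  hopf_isomorphic (hopf_of hU) (drinfeld_double hB hB' phi).
Proof. exact: Urs_double_isomorphic. Qed.
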